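(* Let $d,k\ge 1$ and let $g:(\mathbb{R}^d)^k\to\mathbb{R}$ be a polynomial that is either symmetric or anti-symmetric in its $k$ point arguments. Let $G=(V,E)$ be a $g$-rigid $k$-uniform hypergraph with at least $d+1$ vertices and maximum degree $\Delta_G$, and let $P\subset\mathbb{R}^d$ be a finite set such that for every hypersurface $C\subset\mathbb{R}^d$ of degree at most $\Delta_G\deg g$ we have $|P\cap C|\le \frac{1}{100}|P|$. Then $$|P|^{2|V|}\ll \big|f_{g,G}(P^V)\big|\cdot\big|\mathcal{E}_{V,\Gamma_g}(P)\big|.$$
   Context: A $k$-uniform hypergraph $G=(V,E)$ has unordered hyperedges of $k$ vertices (repeated vertices within a hyperedge allowed, repeated hyperedges not allowed); $\Delta_G$ is the maximum number of hyperedges containing a vertex. Fix a total order on $V$; if $g$ is anti-symmetric, the points of a hyperedge are always input to $g$ in increasing order. The $g$-measurement map is $f_{g,G}:(\mathbb{R}^d)^V\to\mathbb{R}^E$, $p\mapsto \big(g(p(v_1),\dots,p(v_k))\big)_{\{v_1,\dots,v_k\}\in E}$. A pair $(G,p)$ with $p\in(\mathbb{R}^d)^V$ is a framework. A $g$-isometry is an affine map $\gamma(x)=Ax+b$ ($A\in\mathrm{GL}(d)$, $b\in\mathbb{R}^d$) with $g(\gamma x_1,\dots,\gamma x_k)=g(x_1,\dots,x_k)$ for all $x_i$; these form a closed subgroup (a Lie group) $\Gamma_g$ of $\mathrm{Aff}(d)$, acting on $(\mathbb{R}^d)^V$ vertexwise. $(G,p)$ is locally $g$-rigid if there is a Euclidean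 open neighbourhood $N$ of $p$ such that every $q\in N$ with $f_{g,G}(q)=f_{g,G}(p)$ equals $\gamma\cdot p$ for some $\gamma\in\Gamma_g$. A point $p$ is generic if its coordinates are algebraically independent over the field generated over $\mathbb{Q}$ by the coefficients of $f_{g,G}$. $G$ is $g$-rigid if every generic framework $(G,p)$ in $\mathbb{R}^d$ is locally $g$-rigid. A hypersurface of degree at most $D$ is the zero set of a non-zero polynomial of degree at most $D$. For a subgroup $\Gamma$ of $\mathrm{Aff}(d)$, the energy set is $\mathcal{E}_{V,\Gamma}(P)=\{(p,q)\in P^V\times P^V:\ \theta p=q \text{ for some }\theta\in\Gamma\}$, where $(\theta p)(v)=\theta(p(v))$. Notation: $X\ll Y$ means there is a constant $c>0$ (independent of $P$) with $X\le cY$ whenever $|P|$ is sufficiently large; $X\gg Y$ means $Y\ll X$.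
   Formalization: For d ≥ 2, g is also assumed nonconstant: for constant g and |V| = d+1, G is g-rigid and the hypersurface condition is empty, but the bound fails for collinear P; for constant g and |V| > d+1, G is never g-rigid. *)

(* Defs.v *)
From mathcomp Require Import all_boot all_order all_algebra fingroup perm.
From mathcomp Require Import finmap mpoly.
From mathcomp Require Import boolp classical_sets reals topology normedtype.

Set Implicit Arguments.
Unset Strict Implicit.
Unset Printing Implicit Defensive.

Import Order.TTheory GRing.Theory Num.Theory.
Import numFieldTopology.Exports.

Local Open Scope classical_set_scope.
Local Open Scope fset_scope.
Local Open Scope ring_scope.

(* A multiset of k vertices is encoded by its increasing enumeration. *)
Definition hyperedge disp (V : finOrderType disp) (k : nat) : finType :=
  {e : k.-tuple V | sorted <=%O e}.

Definition max_degree disp (V : finOrderType disp) (k : nat)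
    (E : {set hyperedge V k}) : nat :=
  \max_(v : V) #|[set e in E | v \in val e]|.

Notation config R d V := {ffun V -> 'rV[R]_d}.

Section Defs.
Variables (R : realType) (d k : nat) (disp : Order.disp_t).
Variables (V : finOrderType disp).

(* The total degree, with the junk value 0 for the zero polynomial. *)
Definition mpoly_deg n (h : {mpoly R[n]}) : nat := (msize h).-1.

(* A polynomial function of k points of R^d is a polynomial in k * d variables;
   the k points are the rows of a k x d matrix. *)
Definition eval_points (g : {mpoly R[k * d]}) (x : 'M[R]_(k, d)) : R :=
  g.@[mxvec x 0].

Definition block_symmetric (g : {mpoly R[k * d]}) : Prop :=
  forall (s : 'S_k) (x : 'M[R]_(k, d)),
    eval_points g (row_perm s x) = eval_points g x.

Definition block_antisymmetric (g : {mpoly R[k * d]}) : Prop :=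
  forall (s : 'S_k) (x : 'M[R]_(k, d)),
    eval_points g (row_perm s x) = (-1) ^+ s * eval_points g x.

Definition measurement (g : {mpoly R[k * d]}) (E : {set hyperedge V k})
    (p : config R d V) : {ffun {e : hyperedge V k | e \in E} -> R} :=
  [ffun e => eval_points g (\matrix_(i < k) p (tnth (val (val e)) i))].

(* The identification of (R^d)^V with the space of #|V| x d matrices (and, after
   mxvec, with R^(#|V| * d)). *)
Definition config_mx (p : config R d V) : 'M[R]_(#|V|, d) :=
  \matrix_(i < #|V|) p (enum_val i).

(* The coordinate of the measurement map at e, as a polynomial in the #|V| * d
   coordinates of a configuration: the variable for the j-th coordinate of p(v)
   is substituted for the j-th coordinate of the i-th argument of g when v is
   the i-th vertex of e. *)
Definition edge_poly (g : {mpoly R[k * d]}) (e : hyperedge V k) :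
    {mpoly R[#|V| * d]} :=
  comp_mpoly
    [tuple mxvec (\matrix_(i < k, j < d)
        ('X_(mxvec_index (enum_rank (tnth (val e) i)) j) : {mpoly R[#|V| * d]}))
        0 l | l < k * d]
    g.

Lemma edge_polyE (g : {mpoly R[k * d]}) (E : {set hyperedge V k})
    (e : {e : hyperedge V k | e \in E}) (p : config R d V) :
  (edge_poly g (val e)).@[mxvec (config_mx p) 0] = measurement g E p e.
Proof.
rewrite ffunE /edge_poly comp_mpoly_meval /eval_points.
apply: meval_eq => l; rewrite !tnth_map tnth_ord_tuple.
case/mxvec_indexP: l => i j; rewrite !mxvecE !mxE mevalXU mxvecE !mxE.
by rewrite enum_rankK.
Qed.

Definition measurement_coefs (g : {mpoly R[k * d]}) (E : {set hyperedge V k}) :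
    set R :=
  [set c | exists2 e, e \in E & exists m, c = (edge_poly g e)@_m].

(* The subfield of R generated by S (any subfield contains Q). *)
Definition generated_field (S : set R) : set R :=
  smallest [set K : set R | divring_closed (mem K)] S.

Definition generic (g : {mpoly R[k * d]}) (E : {set hyperedge V k})
    (p : config R d V) : Prop :=
  forall h : {mpoly R[#|V| * d]},
    (forall m, generated_field (measurement_coefs g E) h@_m) ->
    h.@[mxvec (config_mx p) 0] = 0 -> h = 0.

Definition affine_group : set ('rV[R]_d -> 'rV[R]_d) :=
  [set th | exists2 A : 'M[R]_d, A \in unitmx &
            exists b : 'rV[R]_d, forall x, th x = x *m A + b].

Definition isometries (g : {mpoly R[k * d]}) : set ('rV[R]_d -> 'rV[R]_d) :=
  [set th | affine_group th /\
            forall x : 'I_k -> 'rV[R]_d,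
              eval_points g (\matrix_(i < k) th (x i)) =
              eval_points g (\matrix_(i < k) x i)].

Definition act (th : 'rV[R]_d -> 'rV[R]_d) (p : config R d V) : config R d V :=
  [ffun v => th (p v)].

Definition locally_rigid (g : {mpoly R[k * d]}) (E : {set hyperedge V k})
    (p : config R d V) : Prop :=
  exists N : set 'M[R]_(#|V|, d),
    [/\ open N, N (config_mx p) &
      forall q : config R d V, N (config_mx q) ->
        measurement g E q = measurement g E p ->
        exists2 th, isometries g th & q = act th p].

Definition rigid (g : {mpoly R[k * d]}) (E : {set hyperedge V k}) : Prop :=
  forall p : config R d V, generic g E p -> locally_rigid g E p.

Definition hypersurface_deg_le (D : nat) (C : set 'rV[R]_d) : Prop :=
  exists h : {mpoly R[d]},
    [/\ h != 0, (mpoly_deg h <= D)%N & C = [set x | h.@[x 0] = 0]].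

Definition configs_in (P : {fset 'rV[R]_d}) : {fset config R d V} :=
  let T : finType := {ffun V -> P} in
  [fset ([ffun v => val ((p : {ffun V -> P}) v)] : config R d V) | p in T]%fset.

Lemma configs_inP (P : {fset 'rV[R]_d}) (p : config R d V) :
  reflect (forall v, p v \in P) (p \in configs_in P).
Proof.
apply: (iffP idP) => [/imfsetP[q /= _ ->] v|pP].
  by rewrite ffunE; exact: valP.
apply/imfsetP; exists [ffun v => [` pP v]%fset : P] => //=.
by apply/ffunP => v; rewrite !ffunE.
Qed.

Definition energy_set (Gam : set ('rV[R]_d -> 'rV[R]_d)) (P : {fset 'rV[R]_d}) :
    {fset config R d V * config R d V} :=
  [fset pq in configs_in P `*` configs_in P
     | `[< exists2 th, Gam th & act th pq.1 = pq.2 >]]%fset.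

End Defs.

(* Main.v *)
(* Gamma_g-orbits of affinely spanning configurations are separated by the polynomials
   h_U(p) = g(U p), where the rows of U are affine weights on the vertices; finitely many U
   suffice, since the h_U span a finite dimensional space.  (A coincidence of all h_U that does
   not come from an isometry would make g blind to translating its arguments along some w <> 0,
   and then a vertex could be moved along w, contradicting rigidity.)

   Each h_U is algebraic over a maximal algebraically independent set F of coordinates of f_{g,G}.
   Otherwise F and h_U extend by coordinate functions to N polynomials with nonzero Jacobian
   determinant; as this square system is open at a generic p, there is q close to p with the same
   F-values, hence the same f_{g,G}-values, but h_U(q) <> h_U(p), contradicting local rigidity.
   Extending F alone gives a Jacobian determinant D of degree at most Delta_G deg g in each
   vertex.  On the part of a fibre of f_{g,G} where D <> 0, the value of h_U is a root of an
   algebraic relation over F; perturbing the points to a nearby fibre over which that relation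
   does not vanish bounds the number of values, hence the number of orbits, by a constant.

   The assumption on P, used one vertex at a time, shows that a positive proportion of P^V
   satisfies D <> 0 and is affinely spanning.  Cauchy-Schwarz on the fibres of (f_{g,G}, (h_U)_U)
   concludes. *)
From HB Require Import structures.
Require Import Defs.
From mathcomp Require Import all_boot all_order all_algebra fingroup perm.
From mathcomp Require Import finmap mpoly.
From mathcomp Require Import interval_inference boolp classical_sets functions.
From mathcomp Require Import reals topology normedtype sequences.
From mathcomp Require Import ring lra zify.

Set Implicit Arguments.
Unset Strict Implicit.
Unset Printing Implicit Defensive.

Import Order.TTheory GRing.Theory Num.Theory.
Import numFieldNormedType.Exports.

Local Open Scope ring_scope.

(** * Polynomial functions on real vector spaces *)

HB.instance Definition _ (R : realType) m n := NormedModule.on 'M[R]_(m, n).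

(** Suited to facts compatible with sums and products: continuity, difference quotients, the chain
    rule, substitution identities. *)
Lemma mpoly_ring_ind (K : comNzRingType) n (P : {mpoly K[n]} -> Prop) :
  (forall c, P c%:MP) -> (forall i, P 'X_i) ->
  (forall p q, P p -> P q -> P (p + q)) ->
  (forall p q, P p -> P q -> P (p * q)) -> forall p, P p.
Proof.
move=> PC PX PD PM p; rewrite (mpolyE p).
elim/big_ind: _ => [|x y Px Py|m _]; first by rewrite -mpolyC0.
  exact: PD.
rewrite -mul_mpolyC; apply: (PM) => //; rewrite mpolyXE_id.
elim/big_ind: _ => [|x y Px Py|i _]; first by rewrite -mpolyC1.
  exact: (PM).
by elim: (m i) => [|k IH]; rewrite ?expr0 -?mpolyC1 // exprS; apply: (PM).
Qed.

Lemma mderivXU (K : nzRingType) n (i j : 'I_n) :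
  mderiv j ('X_i : {mpoly K[n]}) = ((i == j)%:R)%:MP.
Proof.
rewrite mderivX mnm1E; case: eqP => [->|_]; last by rewrite scale0r mpolyC0.
have -> : (U_(j) - U_(j) = 0)%MM by apply/mnmP => l; rewrite mnmBE subnn mnmE.
by rewrite scale1r mpolyX0 mpolyC1.
Qed.

Lemma mx_norm_leP (R : realType) m n (A : 'M[R]_(m, n)) e : 0 <= e ->
  (forall i j, `|A i j| <= e) -> `|A| <= e.
Proof.
move=> e0 H; rewrite [leLHS]/Num.Def.normr/= mx_normrE (bigmax_le _ e0)//=.
Qed.

Section Analysis.
Variables (R : realType) (n : nat).
Implicit Types (h : {mpoly R[n]}) (x y p : 'rV[R]_n).

Lemma rV_norm_le x e : 0 <= e -> (forall j, `|x 0 j| <= e) -> `|x| <= e.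
Proof. by move=> e0 H; apply: mx_norm_leP => // i j; rewrite ord1. Qed.

Lemma coord_norm_le x j : `|x 0 j| <= `|x|.
Proof.
rewrite [leRHS]/Num.Def.normr/= mx_normrE.
by apply/bigmax_geP; right => /=; exists (0, j).
Qed.

Lemma meval_continuous h : continuous (fun x => h.@[x 0]).
Proof.
elim/mpoly_ring_ind: h => [c|i|f g Hf Hg|f g Hf Hg] x.
- have -> : (fun x : 'rV[R]_n => c%:MP.@[x 0]) = fun=> c.
    by apply/funext => z; rewrite mevalC.
  exact: cst_continuous.
- have -> : (fun x : 'rV[R]_n => ('X_i : {mpoly R[n]}).@[x 0]) = fun x => x 0 i.
    by apply/funext => z; rewrite mevalXU.
  exact: coord_continuous.
- have -> : (fun x => (f + g).@[x 0]) = (fun x => f.@[x 0] + g.@[x 0]).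
    by apply/funext => z; rewrite mevalD.
  exact: cvgD (Hf x) (Hg x).
- have -> : (fun x => (f * g).@[x 0]) = (fun x => f.@[x 0] * g.@[x 0]).
    by apply/funext => z; rewrite mevalM.
  exact: cvgM (Hf x) (Hg x).
Qed.

Lemma meval_near h x e : 0 < e ->
  exists2 d, 0 < d & forall y, `|y - x| < d -> `|h.@[y 0] - h.@[x 0]| < e.
Proof.
move=> e0; have /cvgrPdist_lt/(_ e e0) := @meval_continuous h x.
move=> /nbhs_ballP[d /= d0 Hd]; exists d => // y yx.
by rewrite distrC; apply: Hd; rewrite -ball_normE /= distrC.
Qed.

Lemma hadamard h : exists H : 'I_n -> 'rV[R]_n * 'rV[R]_n -> R,
  [/\ forall j, continuous (H j),
      forall x y, h.@[x 0] - h.@[y 0] =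
        \sum_j H j (x, y) * (x 0 j - y 0 j) &
      forall j p, H j (p, p) = (mderiv j h).@[p 0]].
Proof.
elim/mpoly_ring_ind: h => [c|i|f g [F [cF dF F0]] [G [cG dG G0]]|
  f g [F [cF dF F0]] [G [cG dG G0]]].
- exists (fun _ _ => 0); split => [j z|x y|j p]; first exact: cst_continuous.
  + by rewrite !mevalC subrr big1 // => j _; rewrite mul0r.
  + by rewrite mderivC meval0.
- exists (fun j _ => (i == j)%:R); split => [j z|x y|j p]; first exact: cst_continuous.
  + rewrite !mevalXU (bigD1 i) //= eqxx mul1r big1 ?addr0 // => j ji.
    by rewrite eq_sym (negbTE ji) mul0r.
  + by rewrite mderivXU mevalC.
- exists (fun j z => F j z + G j z); split => [j z|x y|j p].
  + exact: cvgD (@cF j z) (@cG j z).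
  + rewrite !mevalD opprD addrACA dF dG -big_split /=.
    by apply: eq_bigr => j _; rewrite mulrDl.
  + by rewrite mderivD mevalD F0 G0.
- exists (fun j z => F j z * g.@[z.1 0] + f.@[z.2 0] * G j z).
  split => [j z|x y|j p].
  + apply: cvgD; apply: cvgM => //; try exact: cF; try exact: cG.
    * by apply: (cvg_comp fst (fun y => g.@[y 0]) cvg_fst (@meval_continuous g z.1)).
    * by apply: (cvg_comp snd (fun y => f.@[y 0]) cvg_snd (@meval_continuous f z.2)).
  + transitivity ((f.@[x 0] - f.@[y 0]) * g.@[x 0]
                  + f.@[y 0] * (g.@[x 0] - g.@[y 0])).
      by rewrite !mevalM; ring.
    rewrite dF dG mulr_suml mulr_sumr -big_split /=.
    by apply: eq_bigr => j _ /=; ring.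
  + by rewrite mderivM mevalD !mevalM F0 G0.
Qed.

End Analysis.

(** Characteristic zero enters here: the coefficient of a non-trivial monomial, multiplied by one of
    its non-zero exponents, is a coefficient of a derivative. *)
Lemma mderiv_eq0_const (K : numDomainType) n (h : {mpoly K[n]}) :
  (forall i, mderiv i h = 0) -> h = (h@_0)%:MP.
Proof.
move=> dh; apply/mpolyP => m; rewrite mcoeffC.
have [->|m0] := eqVneq m 0%MM; first by rewrite mulr1.
rewrite mulr0; have [i mi] : exists i, m i != 0%N.
  apply/existsP; apply: contraNT m0; rewrite negb_exists => /forallP m0.
  by apply/eqP/mnmP => i; move: (m0 i); rewrite negbK mnm0E => /eqP.
have := mcoeff_deriv i (m - U_(i))%MM h; rewrite dh mcoeff0 submK; last first.
  by apply/mnm_lepP => l; rewrite mnm1E; case: eqP => // <-; rewrite lt0n.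
by move/esym/eqP; rewrite -mulr_natr mulf_eq0 pnatr_eq0 orbF => /eqP.
Qed.

Lemma msize_mderiv (K : nzRingType) n (h : {mpoly K[n]}) i :
  (msize (mderiv i h) <= (msize h).-1)%N.
Proof.
rewrite msizeE; apply/bigmax_leqP_seq => m.
rewrite mcoeff_msupp mcoeff_deriv => Hm _.
have /msize_mdeg_lt : (m + U_(i))%MM \in msupp h.
  by rewrite mcoeff_msupp; apply: contraNneq Hm => ->; rewrite mul0rn.
by rewrite mdegD mdeg1; case: (msize h) => // k; rewrite addn1.
Qed.

(** * Non-vanishing points of polynomials and an open mapping theorem *)

Section Avoid.
Variables (R : realType) (n : nat).
Implicit Types (h : {mpoly R[n]}) (x y p : 'rV[R]_n).

Lemma pair_near (H : 'rV[R]_n * 'rV[R]_n -> R) p e : continuous H -> 0 < e ->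
  exists2 d, 0 < d & forall x y, `|x - p| < d -> `|y - p| < d ->
    `|H (x, y) - H (p, p)| < e.
Proof.
move=> cH e0; have /cvgrPdist_lt/(_ e e0) := @cH (p, p).
move=> /nbhs_ballP[d /= d0 Hd]; exists d => // x y xp yp.
by rewrite distrC; apply: Hd; split; rewrite -ball_normE /= distrC.
Qed.

(** Induction on the degree: were a partial derivative non-zero at a point of the ball, a small step
    along that axis would change the value of h. So all derivatives vanish on the ball, hence
    identically, and h is constant. *)
Lemma mpoly_vanish_ball h p d : 0 < d ->
  (forall x, `|x - p| < d -> h.@[x 0] = 0) -> h = 0.
Proof.
move=> d0; have [k] := ubnP (msize h); elim: k h => // k IH h hk Hh.
have dh i : mderiv i h = 0.
  have [->|h0] := eqVneq h 0; first by rewrite mderiv0.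
  apply: IH => [|x xp].
    have := msize_mderiv h i; have : msize h != 0%N by rewrite msize_poly_eq0.
    lia.
  have [H [cH dH H0]] := hadamard h; rewrite -H0; apply/eqP/negPn/negP => Hx.
  have e0 : 0 < `|H i (x, x)| by rewrite normr_gt0.
  (* The step is half the smaller of [d'], within which [H i] stays close to the derivative, and the
     distance left to the boundary of the ball. *)
  have [d' d'0 /(_ (x + (Num.min d' (d - `|x - p|) / 2) *: delta_mx 0 i) x)] :=
    pair_near x (cH i) e0.
  set t := _ / 2; have t0 : 0 < t.
    by rewrite divr_gt0 // lt_min d'0 subr_gt0.
  have nt : `|t *: delta_mx 0 i : 'rV[R]_n| <= t.
    apply: rV_norm_le (ltW t0) _ => j; rewrite !mxE eqxx /=.
    by case: (j == i); rewrite ?mulr1 ?mulr0 ?normr0 ?(gtr0_norm t0) ?(ltW t0).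
  have t1 : t < d'.
    rewrite /t; have : Num.min d' (d - `|x - p|) <= d' by rewrite ge_min lexx.
    lra.
  have t2 : t < d - `|x - p|.
    rewrite /t; have : Num.min d' (d - `|x - p|) <= (d - `|x - p|).
      by rewrite ge_min lexx orbT.
    have : 0 < d - `|x - p| by rewrite subr_gt0.
    lra.
  rewrite addrAC subrr add0r normr0 => /(_ (le_lt_trans nt t1) d'0).
  have := dH (x + t *: delta_mx 0 i) x.
  rewrite Hh; last first.
    rewrite addrAC (le_lt_trans (ler_normD _ _)) //.
    by rewrite -ltrBrDl (le_lt_trans nt).
  rewrite Hh // subrr (bigD1 i) //= big1 => [|j ji]; last first.
    by rewrite !mxE eqxx /= (negbTE ji) mulr0 addr0 subrr mulr0.
  rewrite addr0 !mxE !eqxx mulr1 addrAC subrr add0r => /esym/eqP.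
  rewrite mulf_eq0 (gt_eqF t0) orbF => /eqP ->.
  by rewrite sub0r normrN ltxx.
rewrite (mderiv_eq0_const dh); have := Hh p; rewrite subrr normr0 => /(_ d0).
by rewrite {1}(mderiv_eq0_const dh) mevalC => ->; rewrite mpolyC0.
Qed.

(** Baire's theorem, as the non-vanishing loci are open and dense; numbers that code no index
    contribute the whole space. Countable families are allowed because genericity excludes countably
    many polynomials. *)
Lemma mpoly_avoid (I : countType) (Q : I -> {mpoly R[n]}) y e :
  (forall i, Q i != 0) -> 0 < e ->
  exists2 x, `|x - y| < e & forall i, (Q i).@[x 0] != 0.
Proof.
move=> Q0 e0; pose F (k : nat) := [set x : 'rV[R]_n | forall i : I,
  @choice.unpickle I k = Some i -> (Q i).@[x 0] != 0]%classic.
have : forall k, open (F k) /\ dense (F k).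
  move=> k; case E : (@choice.unpickle I k) => [i|]; last first.
    have -> : F k = setT by apply/seteqP; split => // x _ i; rewrite E.
    by split; [exact: openT | move=> O [x Ox] _; exists x].
  have -> : F k = [set x : 'rV[R]_n | (Q i).@[x 0] != 0]%classic.
    by apply/seteqP; split => [x /(_ i E)//|x Hx j]; rewrite E => -[<-].
  split.
    have := @open_comp _ _ (fun x : 'rV[R]_n => (Q i).@[x 0]) [set t | t != 0]%classic.
    by apply => [x _|]; [exact: meval_continuous | exact: open_neq].
  move=> O [x Ox] oO; apply/not_existsP => HO.
  have : nbhs x O by exact: open_nbhs_nbhs.
  move/nbhs_ballP => [d /= d0 dO]; case/eqP: (Q0 i).
  apply: (@mpoly_vanish_ball _ x d d0) => z zx; apply/eqP/negPn/negP => Qz.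
  apply: (HO z); split => //; apply: dO.
  by rewrite -ball_normE /= distrC.
move/Baire => /(_ (ball y e)) []; first by exists y; exact: ballxx.
  exact: ball_open.
move=> x [yx Fx]; exists x; first by move: yx; rewrite -ball_normE /= distrC.
by move=> i; apply: (Fx (choice.pickle i)) => //; rewrite choice.pickleK.
Qed.

Lemma mpoly_neq0_ex h : h != 0 -> exists x, h.@[x 0] != 0.
Proof.
move=> h0; have [] := @mpoly_avoid unit (fun=> h) 0 1 => //.
by move=> x _ /(_ tt); exists x.
Qed.

Lemma mpoly_eval_inj h h' : (forall x, h.@[x 0] = h'.@[x 0]) -> h = h'.
Proof.
move=> H; apply/eqP/negPn; rewrite -subr_eq0; apply/negP => /mpoly_neq0_ex[x].
by rewrite mevalB H subrr eqxx.
Qed.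

Definition jacobian m (F : m.-tuple {mpoly R[n]}) : 'M[{mpoly R[n]}]_(m, n) :=
  \matrix_(i, j) mderiv j (tnth F i).

Definition meval_tuple m (F : m.-tuple {mpoly R[n]}) x : 'rV[R]_m :=
  \row_i (tnth F i).@[x 0].

Lemma rV_mulmx_norm (B : 'M[R]_n) : exists2 C, 0 < C &
  forall x, `|x *m B| <= C * `|x|.
Proof.
exists (1 + \sum_i \sum_j `|B j i|).
  by rewrite ltr_pwDl // sumr_ge0 // => i _; rewrite sumr_ge0.
move=> x; apply: rV_norm_le => [|i].
  by rewrite mulr_ge0 // addr_ge0 // sumr_ge0 // => i _; rewrite sumr_ge0.
rewrite mxE (le_trans (ler_norm_sum _ _ _)) //.
have : \sum_j `|x 0 j * B j i| <= `|x| * \sum_j `|B j i|.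
  rewrite mulr_sumr; apply: ler_sum => j _; rewrite normrM.
  by rewrite ler_wpM2r // coord_norm_le.
move/le_trans; apply; rewrite mulrC ler_wpM2r //.
have -> : \sum_i \sum_j `|B j i| = \sum_j `|B j i| + \sum_(l < n | l != i) \sum_j `|B j l|.
  by rewrite (bigD1 i).
rewrite addrCA lerDl addr_ge0 // sumr_ge0 // => j _.
by rewrite sumr_ge0.
Qed.

(* Newton's iteration with the derivative frozen at [p] is a contraction of a
   small closed ball. *)
Lemma mpoly_open_map (F : n.-tuple {mpoly R[n]}) p e :
  (\det (jacobian F)).@[p 0] != 0 -> 0 < e ->
  exists2 eta, 0 < eta &
    forall y, `|y - meval_tuple F p| < eta ->
      exists2 x, `|x - p| < e & meval_tuple F x = y.
Proof.
pose J : 'M[R]_n := map_mx (meval (p 0)) (jacobian F).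
rewrite -det_map_mx -/J => Ju e0; have Ju' : J \in unitmx by rewrite unitmxE unitfE.
(* Points are rows, so the derivative of F at p is right multiplication by J^T. *)
pose B := invmx J^T.
have [H HP] : exists H : 'I_n -> 'I_n -> 'rV[R]_n * 'rV[R]_n -> R, forall i,
   [/\ forall j, continuous (H i j),
      forall x y, (tnth F i).@[x 0] - (tnth F i).@[y 0] =
        \sum_j H i j (x, y) * (x 0 j - y 0 j) &
      forall j p, H i j (p, p) = (mderiv j (tnth F i)).@[p 0]].
  by have [H HP] := choice (fun i => hadamard (tnth F i)); exists H.
have [C C0 HC] := rV_mulmx_norm B.
(* This makes C * n * eps at most 1/2, the contraction ratio; the added 1 covers n = 0. *)
pose eps := (2 * C * (n%:R + 1))^-1.
have n0 : 0 < n%:R + 1 :> R by rewrite ltr_wpDl.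
have eps0 : 0 < eps by rewrite invr_gt0 !mulr_gt0.
have [d d0 Hd] : exists2 d, 0 < d & forall i j x y, `|x - p| < d -> `|y - p| < d ->
    `|H i j (x, y) - J i j| < eps.
  have /choice[d Hd] : forall ij : 'I_n * 'I_n, exists d : R, 0 < d /\
    forall x y, `|x - p| < d -> `|y - p| < d ->
    `|H ij.1 ij.2 (x, y) - J ij.1 ij.2| < eps.
    move=> [i j] /=; have [cH _ H0] := HP i.
    have [d d0 Hd] := pair_near p (cH j) eps0; exists d; split=> // x y xp yp.
    by rewrite /J !mxE -H0; apply: Hd.
  exists (\big[Num.min/1]_ij d ij).
    by apply/bigmin_gtP; split=> // ij _; have [] := Hd ij.
  move=> i j x y xp yp; have [_ /(_ x y)] := Hd (i, j); apply.
    by apply: lt_le_trans xp _; apply: bigmin_le_cond.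
  by apply: lt_le_trans yp _; apply: bigmin_le_cond.
pose rho := Num.min d e / 2.
have rho0 : 0 < rho by rewrite divr_gt0 // lt_min d0.
have rhod : rho < d.
  by rewrite /rho; have : Num.min d e <= d; [rewrite ge_min lexx | lra].
have rhoe : rho < e.
  by rewrite /rho; have : Num.min d e <= e; [rewrite ge_min lexx orbT | lra].
(* T then moves p by at most rho / 2, and the ratio 1/2 uses up the other rho / 2, so T preserves
   the closed ball of radius rho. *)
exists (rho / (2 * C)); first by rewrite divr_gt0 // mulr_gt0.
(* Since B is invertible, a fixed point of T solves F x = y. *)
move=> y Hy; pose T x := x - (meval_tuple F x - y) *m B.
pose U := [set x : 'rV[R]_n | `|x - p| <= rho]%classic.
have TL x x' : U x -> U x' -> `|T x - T x'| <= 2^-1 * `|x - x'|.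
  move=> Ux Ux'.
  have -> : T x - T x' = ((x - x') *m J^T
      - (meval_tuple F x - meval_tuple F x')) *m B.
    rewrite mulmxBl mulmxK ?unitmx_tr // /T !mulmxBl.
    by rewrite !opprB; set a := _ *m B; set b := _ *m B; set c := _ *m B;
       apply/rowP => l; rewrite !mxE; ring.
  apply: le_trans (HC _) _.
  suff : `|(x - x') *m J^T - (meval_tuple F x - meval_tuple F x')|
     <= (n%:R * eps) * `|x - x'|.
    move=> HH; apply: (@le_trans _ _ (C * ((n%:R * eps) * `|x - x'|))).
      by rewrite ler_wpM2l // ltW.
    rewrite !mulrA ler_wpM2r // /eps.
    rewrite ler_pdivrMr ?mulr_gt0 // [leRHS](_ : _ = C * (n%:R + 1)).
      by rewrite ler_wpM2l ?ltW // ltrDl.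
    by field.
  apply: rV_norm_le => [|i]; first by rewrite !mulr_ge0 // ltW.
  rewrite !mxE; have [_ -> _] := HP i; rewrite -sumrB.
  apply: le_trans (ler_norm_sum _ _ _) _.
  rewrite -[n in n%:R]card_ord -mulrA mulr_natl -sumr_const.
  apply: ler_sum => j _; rewrite !mxE.
  have -> : (x 0 j - x' 0 j) * (mderiv j (tnth F i)).@[p 0] -
    H i j (x, x') * (x 0 j - x' 0 j) =
    - (H i j (x, x') - J i j) * ((x - x') 0 j) by rewrite !mxE; ring.
  rewrite normrM normrN ler_pM ?coord_norm_le // ltW //.
  by apply: Hd; [apply: le_lt_trans Ux _ | apply: le_lt_trans Ux' _].
have Up : U p by rewrite /U /= subrr normr0 ltW.
have TU : forall x, U x -> U (T x).
  move=> x Ux; have := TL x p Ux Up.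
  have Tp : `|T p - p| <= rho / 2.
    rewrite /T addrAC subrr sub0r normrN (le_trans (HC _)) //.
    move: Hy; rewrite distrC => /ltW Hy.
    rewrite (le_trans (ler_wpM2l (ltW C0) Hy)) //.
    by rewrite le_eqVlt; apply/orP; left; apply/eqP; field; rewrite gt_eqF.
  move=> HT; rewrite /U /= -(subrK (T p) (T x)) -addrA.
  apply: le_trans (ler_normD _ _) _; move: Ux HT Tp; rewrite /U /=; lra.
have funT : isFun _ _ U U T by split.
pose T' : {fun U >-> U} := HB.pack T funT.
have ctr : is_contraction T'.
  have h2 : (0 : R) <= 2^-1 by rewrite invr_ge0.
  exists (NngNum h2); split => /=; first lra.
  by move=> [x x'] [/= Ux Ux']; apply: TL.
have [||x Ux Tx] := banach_fixed_point ctr.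
- have -> : U = closed_ball_ Num.norm p rho.
    by apply/seteqP; split => x; rewrite /U /closed_ball_ /= distrC.
  exact: closed_closed_ball_.
- by exists p.
exists x; first exact: le_lt_trans Ux rhoe.
have /eqP : (meval_tuple F x - y) *m B = 0.
  by move: Tx => /= Tx; rewrite -[LHS]opprK -[X in - X](addKr x) -/(T x) -Tx addNr oppr0.
have Bu : B \in unitmx by rewrite unitmx_inv unitmx_tr.
move/eqP/(congr1 (mulmx^~ (invmx B))); rewrite /= mulmxK // mul0mx => /eqP.
by rewrite subr_eq0 => /eqP.
Qed.

End Avoid.

(** * Algebraic independence *)

Section DegreeBounds.
Variables (K : idomainType) (n : nat).
Implicit Types p q : {mpoly K[n]}.

(** Degree at most a is written [msize <= a.+1], a form that includes the zero polynomial, whose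
    [msize] is 0. *)
Lemma msizeM_leq p q a b : (msize p <= a.+1)%N -> (msize q <= b.+1)%N ->
  (msize (p * q) <= (a + b).+1)%N.
Proof.
have [->|p0] := eqVneq p 0; first by rewrite mul0r msize0.
have [->|q0] := eqVneq q 0; first by rewrite mulr0 msize0.
move=> pa qb; rewrite msizeM // -subn1 leq_subLR add1n.
by rewrite (leq_trans (leq_add pa qb)) // addSn addnS.
Qed.

Lemma msizeC_leq c b : (msize (c%:MP : {mpoly K[n]}) <= b.+1)%N.
Proof. by rewrite msizeC; case: eqP. Qed.

Lemma msize_prod_leq (I : Type) (r : seq I) (P : pred I) (F : I -> {mpoly K[n]}) b :
  (forall i, P i -> (msize (F i) <= (b i).+1)%N) ->
  (msize (\prod_(i <- r | P i) F i) <= (\sum_(i <- r | P i) b i).+1)%N.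
Proof.
move=> Fb; elim/big_rec2: _ => [|i y1 y2 Pi IH]; first by rewrite -mpolyC1 msizeC_leq.
exact: msizeM_leq (Fb i Pi) IH.
Qed.

Lemma msize_sum_leq (I : Type) (r : seq I) (P : pred I) (F : I -> {mpoly K[n]}) b :
  (forall i, P i -> (msize (F i) <= b)%N) -> (msize (\sum_(i <- r | P i) F i) <= b)%N.
Proof.
move=> Fb; elim/big_ind: _ => [|x y xb yb|//]; first by rewrite msize0.
by rewrite (leq_trans (mmeasureD_le _ _ _)) // geq_max xb.
Qed.

Lemma msize_exp_leq p a k : (msize p <= a.+1)%N -> (msize (p ^+ k) <= (k * a).+1)%N.
Proof.
move=> pa; elim: k => [|k IH]; first by rewrite expr0 -mpolyC1 msizeC_leq.
by rewrite exprS mulSn; apply: msizeM_leq.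
Qed.

Lemma msize_comp_leq m (T : m.-tuple {mpoly K[n]}) (p : {mpoly K[m]}) a b :
  (forall i, (msize (tnth T i) <= b.+1)%N) -> (msize p <= a.+1)%N ->
  (msize (p \mPo T) <= (a * b).+1)%N.
Proof.
move=> Tb pa; rewrite comp_mpolyEX big_seq; apply: msize_sum_leq => m' m'p.
apply: leq_trans (_ : msize ('X_[m'] \mPo T) <= _)%N.
  exact: msizeZ_le.
rewrite comp_mpolyX.
apply: leq_trans (msize_prod_leq _ (fun i _ => msize_exp_leq _ (Tb i))) _.
rewrite ltnS -big_distrl /= leq_mul2r -mdegE; apply/orP; right.
by rewrite -ltnS (leq_trans _ pa) // msize_mdeg_lt.
Qed.

(** The bounds go row by row because each term of the Leibniz expansion takes one entry from every
    row. *)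
Lemma msize_det_leq m (M : 'M[{mpoly K[n]}]_m) b :
  (forall i j, (msize (M i j) <= (b i).+1)%N) ->
  (msize (\det M) <= (\sum_i b i).+1)%N.
Proof.
move=> Mb; apply: msize_sum_leq => s _.
apply: (@msizeM_leq _ _ 0).
  case: (odd_perm s); rewrite ?expr1 ?expr0 -?mpolyC1 ?msizeC_leq //.
  by rewrite -mpolyCN msizeC_leq.
exact: msize_prod_leq.
Qed.

End DegreeBounds.

Lemma leq_exp2r_w a b n : (a <= b)%N -> (a ^ n <= b ^ n)%N.
Proof. by move=> ab; elim: n => // n IH; rewrite !expnS leq_mul. Qed.

Section AlgIndep.
Variables (K : fieldType).

(* Quantifying over the tuples with underlying sequence [F] makes the notion
   independent of how the size of [F] is written. *)
Definition algindep n (F : seq {mpoly K[n]}) : Prop :=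
  forall m (G : m.-tuple {mpoly K[n]}), val G = F ->
  forall Q : {mpoly K[m]}, Q \mPo G = 0 -> Q = 0.

Lemma algindep_tuple n m (F : m.-tuple {mpoly K[n]}) :
  (forall Q : {mpoly K[m]}, Q \mPo F = 0 -> Q = 0) -> algindep F.
Proof.
move=> HF m' G GF; have e : m' = m by rewrite -(size_tuple G) GF size_tuple.
by subst m'; have -> : G = F by apply: val_inj.
Qed.

Lemma algindep_nil n : algindep ([::] : seq {mpoly K[n]}).
Proof.
apply: (@algindep_tuple _ _ [tuple]) => Q.
have -> : Q = (Q@_0)%:MP.
  apply/mpolyP => m; rewrite mcoeffC.
  have -> : m = 0%MM by apply/mnmP => -[].
  by rewrite eqxx mulr1.
rewrite comp_mpolyC => /(congr1 (mcoeff 0%MM)).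
by rewrite mcoeffC eqxx mulr1 mcoeff0 => ->; exact: mpolyC0.
Qed.

(** Dimension count: with more than n polynomials, the products with exponents below s outnumber the
    monomials available for their expansions, so they satisfy a linear relation. *)
Lemma algindep_size n (F : seq {mpoly K[n]}) : algindep F -> (size F <= n)%N.
Proof.
rewrite leqNgt => HF; apply/negP => Fn.
pose m := size F; pose G : m.-tuple _ := in_tuple F.
have {}HF := HF m G erefl; rewrite -/m in Fn.
pose B := (\max_(i < m) msize (tnth G i))%N.
have GB i : (msize (tnth G i) <= B.+1)%N by rewrite leqW // (leq_bigmax i).
(* k exceeds the degree of every such product and k <= s (mB + 1), so k^n <= s^n (mB + 1)^n <
   s^(n+1) <= s^m. *)
pose s := ((m * B).+1 ^ n).+1; pose k := ((m * s * B).+1)%N.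
pose A := {ffun 'I_m -> 'I_s}; pose C := {ffun 'I_n -> 'I_k}.
pose mA (a : A) : 'X_{1..m} := [multinom nat_of_ord (a i) | i < m].
pose mC (c : C) : 'X_{1..n} := [multinom nat_of_ord (c i) | i < n].
pose P a : {mpoly K[n]} := 'X_[mA a] \mPo G.
have Pk a : (msize (P a) <= k)%N.
  rewrite /P comp_mpolyX.
  apply: leq_trans (msize_prod_leq _ (fun i _ => msize_exp_leq _ (GB i))) _.
  rewrite ltnS -big_distrl /= leq_mul2r; apply/orP; right.
  apply: leq_trans (_ : \sum_(i < m) s <= _)%N.
    by apply: leq_sum => i _; rewrite mnmE ltnW.
  by rewrite sum_nat_const card_ord.
pose M : 'M[K]_(#|A|, #|C|) := \matrix_(i, j) (P (enum_val i))@_(mC (enum_val j)).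
have CA : (#|C| < #|A|)%N.
  rewrite !card_ffun !card_ord.
  apply: leq_ltn_trans (_ : (s * (m * B).+1) ^ n < _)%N.
    by rewrite leq_exp2r_w // /k; nia.
  rewrite expnMn; apply: leq_trans (_ : s ^ n.+1 <= _)%N.
    by rewrite expnSr ltn_pmul2l ?expn_gt0 // ltnSn.
  by rewrite leq_pexp2l.
have : kermx M != 0.
  rewrite kermx_eq0 /row_free neq_ltn; apply/orP; left.
  exact: leq_ltn_trans (rank_leq_col M) CA.
move/rowV0Pn => [v]; rewrite sub_kermx => /eqP vM; apply/negP; rewrite negbK.
pose Q : {mpoly K[m]} := \sum_i v 0 i *: 'X_[mA (enum_val i)].
have mA_inj : injective mA.
  move=> a a' /mnmP E; apply/ffunP => i; apply: val_inj.
  by have := E i; rewrite !mnmE.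
have Q0 : Q = 0.
  apply: HF; rewrite raddf_sum /=; apply/mpolyP => mm; rewrite mcoeff0 raddf_sum /=.
  under eq_bigr do rewrite comp_mpolyZ mcoeffZ.
  have [lt_mm|ge_mm] := ltnP (mdeg mm) k; last first.
    apply: big1 => i _; rewrite memN_msupp_eq0 ?mulr0 //.
    by apply: msize_mdeg_ge; apply: leq_trans ge_mm; apply: Pk.
  have mmk i : (mm i < k)%N 
    by apply: leq_ltn_trans lt_mm; rewrite mdegE (bigD1 i) //= leq_addr.
  pose c : C := [ffun i => Ordinal (mmk i)].
  have -> : mm = mC c by apply/mnmP => i; rewrite mnmE ffunE.
  have := congr1 (fun x : 'rV_ _ => x 0 (enum_rank c)) vM; rewrite !mxE => {2}<-.
  by apply: eq_bigr => i _; rewrite mxE enum_rankK.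
apply/eqP/rowP => i; rewrite mxE.
have := congr1 (fun q => q@_(mA (enum_val i))) Q0.
rewrite mcoeff0 raddf_sum /= (bigD1 i) //= mcoeffZ mcoeffX eqxx mulr1 big1 ?addr0 //.
move=> j ji; rewrite mcoeffZ mcoeffX; case: eqP => [/mA_inj/enum_val_inj E|_].
  by rewrite E eqxx in ji.
by rewrite mulr0.
Qed.

End AlgIndep.

Section Muni.
Variable K : fieldType.

(** [muni] singles out the last variable, the place where [rcons] puts x: a relation for [rcons F x]
    becomes a univariate equation for x over polynomials in F. *)
Lemma comp_mpoly_muni n m (F : m.-tuple {mpoly K[n]}) x (Q : {mpoly K[m.+1]}) :
  Q \mPo [tuple of rcons F x] = (map_poly (comp_mpoly F) (muni Q)).[x].
Proof.
elim/mpoly_ring_ind: Q => [c|i|p q IHp IHq|p q IHp IHq].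
- by rewrite muniC map_polyC /= hornerC !comp_mpolyC.
- rewrite comp_mpolyXU /muni mmapX mmap1U /= nth_rcons size_tuple.
  case: splitP => [j Ej|j Ej].
    have -> : val i = j by [].
    rewrite ltn_ord map_polyC /= hornerC comp_mpolyXU.
    by apply: set_nth_default; rewrite size_tuple.
  have -> : val i = m by rewrite [LHS]Ej ord1 addn0.
  by rewrite ltnn eqxx map_polyX hornerX.
- by rewrite comp_mpolyD muniD rmorphD hornerD IHp IHq.
- by rewrite rmorphM /= muniM rmorphM hornerM IHp IHq.
Qed.

Lemma muni_eq0 m (Q : {mpoly K[m.+1]}) : muni Q = 0 -> Q = 0.
Proof.
move=> Q0; pose F := [tuple ('X_(widen_ord (leqnSn m) i) : {mpoly K[m.+1]}) | i < m].
have := comp_mpoly_muni F 'X_ord_max Q; rewrite Q0 map_poly0 horner0 => <-.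
rewrite -[LHS]comp_mpoly_id; congr (_ \mPo _); apply: val_inj => /=.
by rewrite enum_ordSr map_rcons -map_comp.
Qed.

Lemma not_algindep_rcons n m (F : m.-tuple {mpoly K[n]}) x :
  ~ algindep (rcons F x) ->
  exists2 q : {poly {mpoly K[m]}}, q != 0 & root (map_poly (comp_mpoly F) q) x.
Proof.
apply: contra_notP => H.
apply: (@algindep_tuple _ _ _ [tuple of rcons F x]) => Q QF.
apply: muni_eq0; apply/eqP/negPn/negP => Q0.
apply: H; exists (muni Q) => //; apply/rootP.
by rewrite -comp_mpoly_muni.
Qed.

Lemma mderiv_comp n m (F : m.-tuple {mpoly K[n]}) (Q : {mpoly K[m]}) j :
  mderiv j (Q \mPo F) =
  \sum_l (mderiv l Q \mPo F) * mderiv j (tnth F l).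
Proof.
elim/mpoly_ring_ind: Q => [c|i|p q IHp IHq|p q IHp IHq].
- rewrite comp_mpolyC mderivC big1 // => l _.
  by rewrite mderivC comp_mpoly0 mul0r.
- rewrite comp_mpolyXU -tnth_nth (bigD1 i) //= big1 ?addr0 => [|l li].
    by rewrite mderivXU eqxx mpolyC1 comp_mpoly1 mul1r.
  by rewrite mderivXU eq_sym (negbTE li) mpolyC0 comp_mpoly0 mul0r.
- rewrite comp_mpolyD mderivD IHp IHq -big_split /=; apply: eq_bigr => l _.
  by rewrite mderivD comp_mpolyD mulrDl.
- rewrite rmorphM /= mderivM IHp IHq mulr_suml mulr_sumr -big_split /=.
  by apply: eq_bigr => l _; rewrite mderivM comp_mpolyD !rmorphM /=; ring.
Qed.

(** Chain rule for an algebraic relation of x over F. What the coefficients of q contribute is left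
    unspecified in [a], since only the factor of the derivative of x matters. *)
Lemma mderiv_horner_comp n m (F : m.-tuple {mpoly K[n]}) (x : {mpoly K[n]})
    (q : {poly {mpoly K[m]}}) :
  exists a : 'I_m -> {mpoly K[n]}, forall j,
    mderiv j (map_poly (comp_mpoly F) q).[x] =
    \sum_l a l * mderiv j (tnth F l) +
    (map_poly (comp_mpoly F) q^`()).[x] * mderiv j x.
Proof.
elim/poly_ind: q => [|q c [a IH]].
  exists (fun=> 0) => j; rewrite deriv0 map_poly0 !horner0 mul0r addr0 mderiv0 big1 //.
  by move=> l _; rewrite mul0r.
exists (fun l => a l * x + (mderiv l c \mPo F)) => j.
rewrite derivD derivC addr0 derivM derivX mulr1 !rmorphD !rmorphM /=.
rewrite map_polyX map_polyC /= !hornerE mderivD mderivM IH mderiv_comp.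
under [\sum_l (_ + _) * _]eq_bigr do rewrite mulrDl mulrAC.
rewrite big_split /= -mulr_suml; ring.
Qed.

End Muni.

(** * The Jacobian criterion in characteristic zero *)

Section Extend.
Variable R : realType.

Lemma deriv_mpoly_neq0 m (q : {poly {mpoly R[m]}}) : (1 < size q)%N -> q^`() != 0.
Proof.
move=> sq; apply/eqP => /polyP/(_ (size q).-2); rewrite coef0 coef_deriv.
have -> : (size q).-2.+1 = (size q).-1 by case: (size q) sq => [|[]].
move/eqP; rewrite -scaler_nat scaler_eq0 pnatr_eq0 -/(lead_coef q).
by rewrite lead_coef_eq0 -size_poly_eq0; case: (size q) sq => [|[]].
Qed.

(** Each coordinate function is algebraic over H; differentiating a relation of minimal degree
    expresses a non-zero multiple of its gradient through the gradients of H. *)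
Lemma jacobian_coordinates n m (H : m.-tuple {mpoly R[n]}) :
  algindep H -> (forall i, ~ algindep (rcons H ('X_i : {mpoly R[n]}))) ->
  exists (A : 'M[{mpoly R[n]}]_(n, m)) (D : 'rV[{mpoly R[n]}]_n),
    (forall i, D 0 i != 0) /\ A *m jacobian H = diag_mx D.
Proof.
move=> Hind Hmax; pose phi : {mpoly R[m]} -> {mpoly R[n]} := comp_mpoly H.
have phi_inj (c : {mpoly R[m]}) : phi c = 0 -> c = 0 by apply: Hind.
have row_ex i : exists aD : ('I_m -> {mpoly R[n]}) * {mpoly R[n]},
    aD.2 != 0 /\ forall j, \sum_l aD.1 l * mderiv j (tnth H l) = aD.2 *+ (i == j).
  pose good k := `[< exists q : {poly {mpoly R[m]}},
    [/\ q != 0, root (map_poly phi q) 'X_i & size q = k] >].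
  have : exists k, good k.
    have [q q0 rq] := not_algindep_rcons (Hmax i).
    by exists (size q); apply/asboolP; exists q.
  case/ex_minnP => k /asboolP[q [q0 rq sq]] kmin.
  have sq1 : (1 < size q)%N.
    rewrite ltnNge; apply: contraNN q0 => /size1_polyC qC; move: rq.
    by rewrite qC map_polyC /= rootC => /eqP/phi_inj ->; rewrite polyC0.
  have [a Ha] := mderiv_horner_comp H 'X_i q.
  exists (a, - (map_poly phi q^`()).['X_i]); split => [/=|j /=].
    (* If q' also vanished at the coordinate function, it would be a shorter relation. *)
    rewrite oppr_eq0; apply/negP => rq'.
    have : good (size q^`()).
      by apply/asboolP; exists q^`(); split=> //; exact: deriv_mpoly_neq0.
    by move/kmin; rewrite -sq leqNgt lt_size_deriv.
  have := Ha j; rewrite (eqP rq) mderiv0 => /esym/eqP; rewrite addr_eq0 => /eqP ->.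
  by rewrite mulNrn mderivXU rmorph_nat mulr_natr.
have [aD HaD] := choice row_ex.
exists (\matrix_(i, l) (aD i).1 l), (\row_i (aD i).2); split => [i|].
  by rewrite mxE; have [] := HaD i.
apply/matrixP => i j; rewrite !mxE; have [_ <-] := HaD i.
by apply: eq_bigr => l _; rewrite !mxE.
Qed.

(** Evaluating the factorisation of the diagonal matrix at a point where it is invertible gives n <=
    m by rank; [algindep_size] gives the converse. Then both factors are square and determinants
    multiply. *)
Lemma jacobian_maximal n m (H : m.-tuple {mpoly R[n]}) :
  algindep H -> (forall i, ~ algindep (rcons H ('X_i : {mpoly R[n]}))) ->
  exists e : m = n, \det (jacobian (tcast e H)) != 0.
Proof.
move=> Hind Hmax; have [A [D [D0 AD]]] := jacobian_coordinates Hind Hmax.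
have P0 : \prod_i D 0 i != 0 by apply/prodf_neq0 => i _.
have nm : (n <= m)%N.
  have [z Pz] := mpoly_neq0_ex P0.
  have := congr1 (map_mx (meval (z 0))) AD; rewrite map_mxM map_diag_mx => E.
  have : \rank (diag_mx (map_mx (meval (z 0)) D)) = n.
    apply: mxrank_unit; rewrite unitmxE unitfE det_diag.
    by under eq_bigr do rewrite mxE; rewrite -rmorph_prod.
  rewrite -E => <-; rewrite (leq_trans (mulmx_max_rank _ _)) //.
have mn : m = n.
  by apply/eqP; rewrite eqn_leq nm -[m](size_tuple H) algindep_size.
exists mn; subst m; rewrite tcast_id.
move/(congr1 determinant): AD; rewrite det_mulmx det_diag => E.
by apply: contraNneq P0 => J0; rewrite -E J0 mulr0.
Qed.

(** Coordinate functions are added as long as independence lasts; [algindep_size] bounds their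
    number, so a maximal extension exists. *)
Lemma algindep_extend n (F : seq {mpoly R[n]}) : algindep F ->
  exists (G : n.-tuple {mpoly R[n]}) (s : seq 'I_n),
    tval G = F ++ [seq 'X_i | i <- s] /\ \det (jacobian G) != 0.
Proof.
move=> HF; pose good k := `[< exists s : seq 'I_n,
   size s = k /\ algindep (F ++ [seq ('X_i : {mpoly R[n]}) | i <- s]) >].
have g0 : exists k, good k.
  by exists 0%N; apply/asboolP; exists [::]; rewrite cats0.
have gb k : good k -> (k <= n)%N.
  move=> /asboolP[s [<- /algindep_size]]; rewrite size_cat size_map.
  by apply: leq_trans; rewrite leq_addl.
have [k /asboolP[s [sk Hs]] kmax] := ex_maxnP g0 gb.
pose H := in_tuple (F ++ [seq ('X_i : {mpoly R[n]}) | i <- s]).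
have [|i Hi|e He] := @jacobian_maximal n _ H.
- exact: Hs.
- have : good k.+1.
    apply/asboolP; exists (rcons s i); rewrite size_rcons sk map_rcons -rcons_cat.
    by split.
  by move/kmax; rewrite ltnn.
- by exists (tcast e H), s; rewrite val_tcast.
Qed.

End Extend.

(** * Fibres of algebraically independent families *)

Lemma uniq_map_inj_in (T T' : eqType) (f : T -> T') (s : seq T) :
  uniq (map f s) -> {in s &, injective f}.
Proof.
move=> fs x y xs ys E; have us := map_uniq fs.
rewrite -(nth_index x xs) -(nth_index x ys); congr nth.
apply/eqP; rewrite -(@nth_uniq _ (f x) (map f s)) ?size_map ?index_mem //.
by rewrite !(nth_map x) ?index_mem // !nth_index // E.
Qed.

Section Fibres.
Variable R : realType.

Lemma common_eps (T : eqType) (s : seq T) (P : T -> R -> Prop) :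
  (forall x e e', e' <= e -> P x e -> P x e') ->
  (forall x, x \in s -> exists2 e, 0 < e & P x e) ->
  exists2 e, 0 < e & forall x, x \in s -> P x e.
Proof.
move=> Pmono; elim: s => [|x s IH] Hs; first by exists 1.
have [|e e0 He] := IH; first by move=> y ys; apply: Hs; rewrite inE ys orbT.
have [|e' e'0 He'] := Hs x; first by rewrite inE eqxx.
exists (Num.min e e'); first by rewrite lt_min e0.
move=> y; rewrite inE => /orP[/eqP->|ys].
  by apply: Pmono He'; rewrite ge_min lexx orbT.
by apply: Pmono (He _ ys); rewrite ge_min lexx.
Qed.

Lemma poly_roots_seq (r : {poly R}) : r != 0 ->
  exists rs : seq R, forall t, root r t -> t \in rs.
Proof.
have [k] := ubnP (size r); elim: k r => // k IH r rk r0.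
have [[a ra]|nr] := pselect (exists a, root r a); last first.
  by exists [::] => t rt; case: nr; exists t.
have [q rq] := factor_theorem _ _ ra; have q0 : q != 0.
  by apply: contraNneq r0 => q0; rewrite rq q0 mul0r.
have [|rs Hrs] := IH q _ q0.
  by move: rk; rewrite rq size_Mmonic ?monicXsubC // size_XsubC addn2.
exists (a :: rs) => t; rewrite rq rootM root_XsubC inE => /orP[/Hrs->|->] //.
by rewrite orbT.
Qed.

Lemma root_isolated (r : {poly R}) t0 : r != 0 ->
  exists2 e, 0 < e & forall t, root r t -> `|t - t0| < e -> t = t0.
Proof.
move=> /poly_roots_seq[rs Hrs].
have [||e e0 He] := @common_eps _ rs (fun t e => `|t - t0| < e -> t = t0).
- by move=> t e e' ee' H te; apply: H; apply: lt_le_trans te ee'.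
- move=> t _; have [->|tt0] := eqVneq t t0; first by exists 1.
  by exists `|t - t0|; rewrite ?ltxx // normr_gt0 subr_eq0.
by exists e => // t /Hrs/He.
Qed.

Lemma comp_mpoly_meval_tuple n m (F : m.-tuple {mpoly R[n]}) (c : {mpoly R[m]})
    (x : 'rV[R]_n) : (c \mPo F).@[x 0] = c.@[meval_tuple F x 0].
Proof. by rewrite comp_mpoly_meval; apply: meval_eq => i; rewrite mxE. Qed.

Lemma root_comp_meval n m (F : m.-tuple {mpoly R[n]}) (q : {poly {mpoly R[m]}})
    (h : {mpoly R[n]}) (x : 'rV[R]_n) :
  root (map_poly (comp_mpoly F) q) h ->
  root (map_poly (meval (meval_tuple F x 0)) q) h.@[x 0].
Proof.
move=> /rootP/(congr1 (meval (x 0))); rewrite meval0 -horner_map /= -map_poly_comp.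
move=> H; apply/rootP; rewrite -[RHS]H; congr (_.[_]).
by apply: eq_map_poly => c /=; rewrite comp_mpoly_meval_tuple.
Qed.

Lemma map_meval_neq0 m (q : {poly {mpoly R[m]}}) (z : 'rV[R]_m) :
  (lead_coef q).@[z 0] != 0 -> map_poly (meval (z 0)) q != 0.
Proof.
move=> qz; apply/eqP => /polyP/(_ (size q).-1); rewrite coef0 coef_map /=.
by move/eqP; rewrite (negbTE qz).
Qed.

(* A common perturbation moves all the points to a fibre of [F] over which
   [q] does not vanish; by continuity the values of [h] stay distinct. *)
Lemma fibre_values_bound n m (F : m.-tuple {mpoly R[n]}) (G : n.-tuple {mpoly R[n]})
    (T : seq {mpoly R[n]}) (q : {poly {mpoly R[m]}}) (h : {mpoly R[n]})
    (ps : seq 'rV[R]_n) :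
  tval G = F ++ T -> q != 0 -> root (map_poly (comp_mpoly F) q) h ->
  (forall p, p \in ps -> (\det (jacobian G)).@[p 0] != 0) ->
  (forall p p', p \in ps -> p' \in ps -> meval_tuple F p = meval_tuple F p') ->
  uniq [seq h.@[p 0] | p : 'rV[R]_n <- ps] -> (size ps < size q)%N.
Proof.
move=> GFT q0 rq Gps Fps hps.
case Eps : ps => [|p0 ps']; first by rewrite lt0n size_poly_eq0.
have p0ps : p0 \in ps by rewrite Eps inE eqxx.
rewrite -Eps => {ps' Eps}; pose y0 := meval_tuple F p0.
(* [eps] is a lower bound for the gaps between distinct values of h at the given points. *)
have [||eps eps0 Heps] := @common_eps _ [seq (p, p') | p <- ps, p' <- ps]
  (fun pp e => h.@[pp.1 0] != h.@[pp.2 0] -> e <= `|h.@[pp.1 0] - h.@[pp.2 0]|).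
- by move=> x e e' ee' H /H; apply: le_trans.
- move=> [p p'] _ /=; have [E|N] := eqVneq h.@[p 0] h.@[p' 0]; first by exists 1.
  by exists `|h.@[p 0] - h.@[p' 0]|; rewrite ?normr_gt0 ?subr_eq0.
(* [eta] is a perturbation of G that every point can follow while h moves by less than eps / 2. *)
have [||eta eta0 Heta] := @common_eps _ ps (fun p eta =>
   forall y, `|y - meval_tuple G p| < eta ->
     exists2 x : 'rV[R]_n, `|h.@[x 0] - h.@[p 0]| < eps / 2
     & meval_tuple G x = y).
- by move=> p e e' ee' H y ye; apply: H; apply: lt_le_trans ee'.
- move=> p pps; have e20 : 0 < eps / 2 by rewrite divr_gt0.
  have [d d0 Hd] := meval_near h p e20.
  have [eta eta0 Heta] := mpoly_open_map (Gps _ pps) d0.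
  by exists eta => // y /Heta[x xp Gx]; exists x => //; apply: Hd.
have lq0 : lead_coef q != 0 by rewrite lead_coef_eq0.
have [z zy /(_ tt) qz] := @mpoly_avoid R m unit (fun=> lead_coef q) y0 eta (fun=> lq0) eta0.
have /choice[X HX] : forall p, exists x : 'rV[R]_n, p \in ps ->
    `|h.@[x 0] - h.@[p 0]| < eps / 2 /\ meval_tuple F x = z.
  move=> p; have [pps|] := boolP (p \in ps); last by exists 0.
  (* The target has the F-values z common to all points, while the remaining components of G keep
     their values at p. *)
  pose y : 'rV[R]_n := \row_i (if insub (i : nat) is Some j then z 0 j
     else (tnth G i).@[p 0]).
  have mn : (m <= n)%N by rewrite -(size_tuple G) GFT size_cat size_tuple leq_addr.
  have GF (j : 'I_m) : tnth G (widen_ord mn j) = tnth F j.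
    by rewrite !(tnth_nth 0) GFT nth_cat size_tuple /= ltn_ord.
  have [|x xp Gx] := Heta p pps y.
    apply: le_lt_trans zy; apply: rV_norm_le => // i; rewrite !mxE.
    case: insubP => [j _ Ej|_]; last by rewrite subrr normr0.
    have -> : i = widen_ord mn j by apply: val_inj.
    have -> : (tnth G (widen_ord mn j)).@[p 0] = y0 0 j.
      by rewrite /y0 (Fps _ _ p0ps pps) mxE GF.
    by have := coord_norm_le (z - y0) j; rewrite !mxE.
  exists x => _; split=> //; apply/rowP => j.
  have := congr1 (fun v : 'rV_n => v 0 (widen_ord mn j)) Gx.
  rewrite !mxE GF => ->; case: insubP => [j' _ Ej|]; last by rewrite /= ltn_ord.
  by congr (z 0 _); apply: val_inj.
pose r := map_poly (meval (z 0)) q; have r0 : r != 0 by apply: map_meval_neq0.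
have : (size [seq h.@[X p 0%R] | p <- ps] < size r)%N.
  apply: max_poly_roots => //.
    apply/allP => t /mapP[p pps ->]; rewrite /r; have [_ <-] := HX p pps.
    exact: root_comp_meval.
  rewrite map_inj_in_uniq ?(map_uniq hps) // => p p' pps pps' E.
  apply/eqP/negPn/negP => pp'.
  have hpp' : h.@[p 0] != h.@[p' 0].
    by apply: contraNneq pp' => /(uniq_map_inj_in hps pps pps') ->.
  have := Heps (p, p') (allpairs_f _ pps pps') hpp'; rewrite /= leNgt => /negP[].
  have [H1 _] := HX p pps; have [H2 _] := HX p' pps'.
  have -> : h.@[p 0] - h.@[p' 0] =
    (h.@[X p' 0] - h.@[p' 0]) - (h.@[X p 0] - h.@[p 0]) by rewrite E; ring.
  by rewrite (le_lt_trans (ler_normB _ _)) // [eps]splitr ltrD.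
by rewrite size_map => /leq_trans; apply; rewrite size_poly.
Qed.

(** If F and h were independent, an extension to a square system with non-zero Jacobian would allow
    h to vary alone. Near a suitable point every f in fs is fixed along with F, because its values
    are isolated roots of a polynomial determined by F; so h would have to be constant. The family B
    carries the genericity conditions. *)
Lemma locally_constant_dependent n m (F : m.-tuple {mpoly R[n]})
    (fs : seq {mpoly R[n]}) (h : {mpoly R[n]}) (I : countType)
    (B : I -> {mpoly R[n]}) :
  algindep F ->
  (forall f, f \in fs -> f \in F \/ ~ algindep (rcons F f)) ->
  (forall i, B i != 0) ->
  (forall x : 'rV[R]_n, (forall i, (B i).@[x 0] != 0) ->
     exists2 e, 0 < e & forall z : 'rV[R]_n, `|z - x| < e ->
       (forall f, f \in fs -> f.@[z 0] = f.@[x 0]) -> h.@[z 0] = h.@[x 0]) ->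
  ~ algindep (rcons F h).
Proof.
move=> Find Hfs B0 hloc /[dup] hind /algindep_extend[G [s [GE J0]]].
(* Where [c f] does not vanish, the relation for f over F specialises to a non-zero polynomial, so f
   takes finitely many values on the fibre of F. *)
have /choice[c Hc] : forall f, exists c : {mpoly R[n]}, f \in fs -> c != 0 /\
    forall x : 'rV[R]_n, c.@[x 0] != 0 -> exists2 r : {poly R}, r != 0 &
      forall z, meval_tuple F z = meval_tuple F x -> root r f.@[z 0].
  move=> f; have [ffs|] := boolP (f \in fs); last by exists 0.
  have [fF|/not_algindep_rcons[q q0 rq]] := Hfs f ffs.
    exists 1 => _; split=> [|x _]; first exact: oner_neq0.
    exists ('X - (f.@[x 0])%:P); first by rewrite polyXsubC_eq0.
    move=> z Fz; rewrite root_XsubC; have /tnthP[i ->] := fF.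
    by have := congr1 (fun v : 'rV_m => v 0 i) Fz; rewrite !mxE => ->.
  exists (lead_coef q \mPo F) => _; split.
    by apply/negP => /eqP/(Find _ _ erefl)/eqP; rewrite lead_coef_eq0 (negbTE q0).
  move=> x; rewrite comp_mpoly_meval_tuple => /map_meval_neq0 rx0.
  by eexists; first exact: rx0; move=> z <-; apply: root_comp_meval.
pose P := \det (jacobian G) * \prod_(f <- fs) c f.
have P0 : P != 0.
  rewrite mulf_neq0 // prodf_seq_neq0; apply/allP => f ffs.
  by apply/implyP => _; have [] := Hc f ffs.
have [|x _ Bx] := @mpoly_avoid R n (option I)
  (fun o => if o is Some i then B i else P) 0 1 _ ltr01.
  by case.
have [e1 e10 He1] := hloc x (fun i => Bx (Some i)).
have := Bx None; rewrite /P mevalM mulf_eq0 negb_or => /andP[Jx _].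
have [||e2 e20 He2] := @common_eps _ fs (fun f e => forall z : 'rV[R]_n, `|z - x| < e ->
   meval_tuple F z = meval_tuple F x -> f.@[z 0] = f.@[x 0]).
- by move=> f e e' ee' H z ze; apply: H; apply: lt_le_trans ee'.
- move=> f ffs; have [_ Hf] := Hc f ffs.
  have [|r r0 Hr] := Hf x.
    by move: Bx => /(_ None); rewrite mevalM mulf_eq0 negb_or rmorph_prod /=
      prodf_seq_neq0 => /andP[_ /allP/(_ f ffs)].
  have [e e0 He] := root_isolated (f.@[x 0]) r0.
  have [d d0 Hd] := meval_near f x e0; exists d => // z zx Fz.
  by apply: He; [exact: Hr | exact: Hd].
pose e := Num.min e1 e2; have e0 : 0 < e by rewrite lt_min e10.
have [eta eta0 Heta] := mpoly_open_map Jx e0.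
have mn : (m < n)%N.
  by rewrite -(size_tuple G) GE size_cat size_rcons size_tuple leq_addr.
have Gm : tnth G (Ordinal mn) = h.
  rewrite (tnth_nth 0) GE nth_cat size_rcons size_tuple /= ltnSn.
  by rewrite nth_rcons size_tuple ltnn eqxx.
have GF (j : 'I_m) : tnth G (widen_ord (ltnW mn) j) = tnth F j.
  rewrite !(tnth_nth 0) GE nth_cat size_rcons size_tuple /= ltnW ?ltnS ?ltn_ord //.
  by rewrite nth_rcons size_tuple ltn_ord.
(* Only the component belonging to h is shifted. *)
pose y : 'rV[R]_n := meval_tuple G x + (eta / 2) *: delta_mx 0 (Ordinal mn).
have [|z zx Gz] := Heta y.
  rewrite /y addrAC subrr add0r; apply: (@le_lt_trans _ _ (eta / 2)); last lra.
  apply: rV_norm_le => [|j]; first by rewrite divr_ge0 // ltW.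
  rewrite !mxE; case: (_ && _); rewrite ?mulr1 ?mulr0 ?normr0 ?gtr0_norm //; lra.
have Fz : meval_tuple F z = meval_tuple F x.
  apply/rowP => j; have := congr1 (fun v : 'rV_n => v 0 (widen_ord (ltnW mn) j)) Gz.
  rewrite !mxE GF => ->.
  have -> : (widen_ord (ltnW mn) j == Ordinal mn) = false.
    by rewrite -val_eqE /= ltn_eqF.
  by rewrite andbF mulr0 addr0.
have hz : h.@[z 0] = h.@[x 0].
  apply: He1 => [|f ffs]; first by apply: lt_le_trans zx _; rewrite ge_min lexx.
  by apply: He2 => //; apply: lt_le_trans zx _; rewrite ge_min lexx orbT.
have := congr1 (fun v : 'rV_n => v 0 (Ordinal mn)) Gz.
rewrite !mxE Gm hz !eqxx mulr1 => /eqP; rewrite -subr_eq0 opprD addrA subrr sub0r oppr_eq0.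
by apply/negP; rewrite gt_eqF // divr_gt0.
Qed.

End Fibres.

(** * Configurations and invariants of isometries *)

Section CountableField.
Variables (R : realType) (J : countType) (a : J -> R).

(** Trees over a countable type are countable and serve as field expressions. The two labels are the
    operations of [divring_closed]; every other shape is read as 1. *)
Fixpoint field_eval (t : GenTree.tree J) : R :=
  match t with
  | GenTree.Leaf j => a j
  | GenTree.Node 1 [:: x; y] => field_eval x - field_eval y
  | GenTree.Node 2 [:: x; y] => field_eval x / field_eval y
  | GenTree.Node _ _ => 1
  end.

Lemma generated_field_eval (S : set R) c :
  (forall x, S x -> exists j, a j = x) -> generated_field S c ->
  exists t, field_eval t = c.
Proof.
move=> Sa; pose K : set R := [set x | exists t, field_eval t = x]%classic.
move=> /(_ K); apply; split; last by move=> x /Sa[j <-]; exists (GenTree.Leaf j).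
split; rewrite ?in_setE.
- by exists (GenTree.Node 0 [::]).
- move=> x y; rewrite !in_setE => -[t <-] [t' <-].
  by exists (GenTree.Node 1 [:: t; t']).
- move=> x y; rewrite !in_setE => -[t <-] [t' <-].
  by exists (GenTree.Node 2 [:: t; t']).
Qed.

Lemma generated_field_mpoly n (S : set R) :
  (forall x, S x -> exists j, a j = x) ->
  exists (I : countType) (B : I -> {mpoly R[n]}), (forall i, B i != 0) /\
    forall h : {mpoly R[n]}, h != 0 -> (forall m, generated_field S h@_m) ->
    exists i, h = B i.
Proof.
move=> Sa.
pose P (s : seq ('X_{1..n} * GenTree.tree J)) : {mpoly R[n]} :=
  \sum_(mt <- s) field_eval mt.2 *: 'X_[mt.1].
(* Lists that encode the zero polynomial are sent to 1, so that the family has no zero member. *)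
exists (seq ('X_{1..n} * GenTree.tree J)), (fun s => if P s == 0 then 1 else P s).
split=> [s|h h0 Hh]; first by case: ifP => [_|->]; rewrite ?oner_neq0.
have /choice[t Ht] : forall m, exists t, field_eval t = h@_m.
  by move=> m; apply: generated_field_eval Sa (Hh m).
exists [seq (m, t m) | m <- msupp h].
have -> : P [seq (m, t m) | m <- msupp h] = h.
  rewrite /P big_map [RHS]mpolyE; apply: eq_bigr => m _ /=.
  by rewrite Ht.
by rewrite (negbTE h0).
Qed.

End CountableField.

Section Configurations.
Variables (R : realType) (d k : nat) (disp : Order.disp_t).
Variables (V : finOrderType disp).
Local Notation N := (#|V| * d)%N.
Implicit Types (g : {mpoly R[k * d]}) (E : {set hyperedge V k}).
Implicit Types (p q : config R d V).

Definition config_pt p : 'rV[R]_N := mxvec (config_mx p).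

Definition pt_config (x : 'rV[R]_N) : config R d V :=
  [ffun v => row (enum_rank v) (vec_mx x)].

Lemma config_mxK (P : 'M[R]_(#|V|, d)) : config_mx (pt_config (mxvec P)) = P.
Proof.
by apply/matrixP => i j; rewrite mxE ffunE mxvecK enum_valK mxE.
Qed.

Lemma pt_configK x : config_pt (pt_config x) = x.
Proof. by rewrite -{1}[x]vec_mxK /config_pt config_mxK vec_mxK. Qed.

Lemma row_config_mx p v : row (enum_rank v) (config_mx p) = p v.
Proof. by apply/rowP => j; rewrite !mxE enum_rankK. Qed.

Lemma edge_poly_measurement g E p (e : {e : hyperedge V k | e \in E}) :
  (edge_poly g (val e)).@[config_pt p 0] = measurement g E p e.
Proof. exact: edge_polyE. Qed.

Lemma measurement_eqP g E p q :
  measurement g E p = measurement g E q <->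
  forall e, e \in E -> (edge_poly g e).@[config_pt p 0] = (edge_poly g e).@[config_pt q 0].
Proof.
split=> [H e eE|H].
  have /= -> := edge_poly_measurement g p (exist _ e eE).
  by have /= -> := edge_poly_measurement g q (exist _ e eE); rewrite H.
by apply/ffunP => e; rewrite -!edge_poly_measurement H //; apply: valP.
Qed.

(** Only countably many polynomials have coefficients in the field of genericity, so [mpoly_avoid]
    can produce generic points. *)
Lemma generic_family g E : exists (I : countType) (B : I -> {mpoly R[N]}),
  (forall i, B i != 0) /\
  forall p, (forall i, (B i).@[config_pt p 0] != 0) -> generic g E p.
Proof.
pose a (em : hyperedge V k * 'X_{1..N}) := (edge_poly g em.1)@_em.2.
have Sa x : measurement_coefs g E x -> exists j, a j = x.
  by move=> [e _ [m ->]]; exists (e, m).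
have [I [B [B0 HB]]] := @generated_field_mpoly R _ a N _ Sa.
exists I, B; split=> // p Bp h hK hp; apply/eqP/negPn/negP => h0.
by have [i Ei] := HB h h0 hK; have := Bp i; rewrite -Ei hp eqxx.
Qed.

Lemma locally_rigid_ball g E p : locally_rigid g E p ->
  exists2 e, 0 < e & forall q, `|config_pt q - config_pt p| < e ->
    measurement g E q = measurement g E p ->
    exists2 th, isometries g th & q = act th p.
Proof.
move=> [W [oW Wp HW]]; have : nbhs (config_mx p) W by apply: open_nbhs_nbhs.
move/nbhs_ballP => [e /= e0 He]; exists e => // q qp; apply: HW; apply: He.
rewrite -ball_normE /=; apply: le_lt_trans qp; apply: mx_norm_leP => // i j.
have := coord_norm_le (config_pt q - config_pt p) (mxvec_index i j).
rewrite /config_pt -linearB mxvecE; apply: le_trans.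
have -> : config_mx p - config_mx q = - (config_mx q - config_mx p) by rewrite opprB.
by rewrite [in leLHS]mxE normrN.
Qed.

Definition comb_poly g (U : 'M[R]_(k, #|V|)) : {mpoly R[N]} :=
  g \mPo [tuple mxvec (\matrix_(i < k, j < d)
     \sum_v U i v *: ('X_(mxvec_index v j) : {mpoly R[N]})) 0 l | l < k * d].

Lemma comb_polyE g U p :
  (comb_poly g U).@[config_pt p 0] = eval_points g (U *m config_mx p).
Proof.
rewrite /comb_poly comp_mpoly_meval /eval_points; apply: meval_eq => l.
rewrite !tnth_map tnth_ord_tuple; case/mxvec_indexP: l => i j.
rewrite !mxvecE !mxE raddf_sum /=; apply: eq_bigr => v _.
by rewrite mevalZ mevalXU mxvecE.
Qed.

(** Each row describes an affine combination, which is why such weights commute with affine maps. *)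
Definition affine_weights m : set 'M[R]_(m, #|V|) :=
  [set U | U *m const_mx 1 = const_mx 1 :> 'cV[R]_m]%classic.

Lemma config_mx_act A b p (th : 'rV[R]_d -> 'rV[R]_d) :
  (forall x, th x = x *m A + b) ->
  config_mx (act th p) = config_mx p *m A + const_mx 1 *m b.
Proof.
move=> Hth; apply/row_matrixP => i; rewrite -[i]enum_valK [RHS]linearD /= row_config_mx.
rewrite ffunE Hth !row_mul row_config_mx; congr (_ + _).
rewrite (_ : row _ (const_mx 1) = 1%:M) ?mul1mx //.
by apply/rowP => j; rewrite !ord1 !mxE eqxx.
Qed.

Lemma affine_weights_act A b p (th : 'rV[R]_d -> 'rV[R]_d) m (U : 'M[R]_(m, #|V|)) :
  (forall x, th x = x *m A + b) -> affine_weights U ->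
  U *m config_mx (act th p) = \matrix_i th (row i (U *m config_mx p)).
Proof.
move=> Hth HU; rewrite (config_mx_act _ Hth) mulmxDr !mulmxA HU.
apply/row_matrixP => i; rewrite rowK Hth linearD /= row_mul; congr (_ + _).
rewrite row_mul (_ : row _ (const_mx 1) = 1%:M) ?mul1mx //.
by apply/rowP => j; rewrite !ord1 !mxE eqxx.
Qed.

Lemma comb_poly_isometry g (U : 'M[R]_(k, #|V|)) th p :
  affine_weights U -> isometries g th ->
  (comb_poly g U).@[config_pt (act th p) 0] = (comb_poly g U).@[config_pt p 0].
Proof.
move=> HU [[A _ [b Hth]] gth]; rewrite !comb_polyE (affine_weights_act _ Hth) //.
rewrite (gth (fun i => row i (U *m config_mx p))); congr eval_points.
by apply/row_matrixP => i; rewrite rowK.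
Qed.

End Configurations.

(** * Rigid hypergraphs and affine frames *)

Section Rigid.
Variables (R : realType) (d k : nat) (disp : Order.disp_t).
Variables (V : finOrderType disp) (g : {mpoly R[k * d]}).
Variables (E : {set hyperedge V k}).
Hypothesis hrigid : rigid g E.
Local Notation N := (#|V| * d)%N.
Implicit Types (p q : config R d V).

(** Near a generic point, rigidity puts the fibre of the measurement map into one orbit, and the
    invariant is constant on orbits. *)
Lemma comb_poly_dependent m (F : m.-tuple {mpoly R[N]}) U :
  algindep F ->
  (forall e, e \in E -> edge_poly g e \in F \/ ~ algindep (rcons F (edge_poly g e))) ->
  affine_weights U -> ~ algindep (rcons F (comb_poly g U)).
Proof.
move=> Find HE HU; have [I [B [B0 HB]]] := generic_family g E.
apply: (@locally_constant_dependent R N m F [seq edge_poly g e | e <- enum E] _ I B) => //.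
  by move=> f /mapP[e]; rewrite mem_enum => /HE H ->.
move=> x Bx; have [|e e0 He] := @locally_rigid_ball _ _ _ _ _ g E (pt_config x).
  by apply: hrigid; apply: HB => i; rewrite pt_configK.
exists e => // z zx fzx; have [| |th thg Ez] := He (pt_config z).
- by rewrite !pt_configK.
- apply/measurement_eqP => e' e'E; rewrite !pt_configK; apply: fzx.
  by apply/mapP; exists e'; rewrite ?mem_enum.
- have := @comb_poly_isometry _ _ _ _ _ g U th (pt_config x) HU thg.
  by rewrite -Ez !pt_configK.
Qed.

Hypothesis hV : (1 + d <= #|V|)%N.
Let fi := widen_ord hV.

(** The column of ones turns affine independence of the first 1 + d points into invertibility. *)
Definition frame_mx p : 'M[R]_(1 + d) :=
  row_mx (const_mx 1) (rowsub fi (config_mx p)).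

Definition frame_det : {mpoly R[N]} :=
  \det (row_mx (const_mx 1)
     (\matrix_(i < 1 + d, j < d) ('X_(mxvec_index (fi i) j) : {mpoly R[N]}))).

Lemma frame_detE p : frame_det.@[config_pt p 0] = \det (frame_mx p).
Proof.
rewrite -det_map_mx map_row_mx; congr (\det (row_mx _ _)).
  by apply/matrixP => i j; rewrite !mxE rmorph1.
apply/matrixP => i j; rewrite [LHS]mxE [X in _ X = _]mxE [RHS]mxE /= mevalXU.
by rewrite /config_pt mxvecE.
Qed.

Lemma frame_mx_unitE p : (frame_mx p \in unitmx) = (frame_det.@[config_pt p 0] != 0).
Proof. by rewrite frame_detE unitmxE unitfE. Qed.

Lemma standard_frame : exists p, frame_mx p \in unitmx.
Proof.
(* The origin and the standard basis vectors; all other vertices sit at the origin. *)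
pose C : 'M[R]_(1 + d, d) := col_mx 0 1%:M.
pose P : 'M[R]_(#|V|, d) :=
  \matrix_(i, j) (if insub (i : nat) is Some i' then C i' j else 0).
exists (pt_config (mxvec P)).
have PC : rowsub fi P = C.
  by apply/matrixP => i j; rewrite [LHS]mxE [LHS]mxE (valK i).
rewrite unitmxE unitfE /frame_mx config_mxK PC -[const_mx 1]vsubmxK.
by rewrite -block_mxEh det_lblock det1 mulr1 det_mx11 !mxE oner_neq0.
Qed.

Lemma frame_det_neq0 : frame_det != 0.
Proof.
have [p] := standard_frame; rewrite frame_mx_unitE.
by apply: contraNneq => ->; rewrite meval0.
Qed.

(* [U] only involves the frame vertices, so that it reads off the same points
   from all configurations that agree there. *)
Lemma frame_weights p m (X : 'M[R]_(m, d)) : frame_mx p \in unitmx ->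
  exists U, [/\ affine_weights U, U *m config_mx p = X &
    forall q q', (forall i, q (enum_val (fi i)) = q' (enum_val (fi i))) ->
      U *m config_mx q = U *m config_mx q'].
Proof.
move=> pu; pose L := row_mx (const_mx 1) X *m invmx (frame_mx p).
have LP : L *m frame_mx p = row_mx (const_mx 1) X by rewrite mulmxKV.
move: LP; rewrite /frame_mx mul_mx_row => /eq_row_mx[L1 LX].
exists (L *m rowsub fi 1%:M); split=> [||q q' qq'].
- rewrite /affine_weights /= -mulmxA mul_rowsub_mx mul1mx -L1; congr (_ *m _).
  by apply/matrixP => i j; rewrite !mxE.
- by rewrite -mulmxA mul_rowsub_mx mul1mx.
- have E' : rowsub fi (config_mx q) = rowsub fi (config_mx q').
    by apply/matrixP => i j; rewrite !mxE qq'.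
  by rewrite -!(mulmxA L) !mul_rowsub_mx !mul1mx E'.
Qed.

(** Both frames start with a column of ones, so the matrix carrying one to the other has first
    column (1, 0); its remaining blocks are b and A, and det A is its determinant. *)
Lemma frame_affine p q : frame_mx p \in unitmx -> frame_mx q \in unitmx ->
  exists A b, A \in unitmx /\
    forall i, q (enum_val (fi i)) = p (enum_val (fi i)) *m A + b.
Proof.
move=> pu qu; pose B := invmx (frame_mx p) *m frame_mx q.
have pB : frame_mx p *m B = frame_mx q by rewrite mulKVmx.
have Bl : lsubmx B = col_mx 1%:M 0.
  apply: (can_inj (mulKmx pu)); rewrite mulmx_lsub pB row_mxKl mul_row_col.
  by rewrite mulmx1 mulmx0 addr0.
pose b := usubmx (rsubmx B); pose A := dsubmx (rsubmx B).
have BE : B = block_mx 1%:M b 0 A by rewrite block_mxEh vsubmxK -Bl hsubmxK.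
exists A, b; split=> [|i].
  have : B \in unitmx by rewrite unitmx_mul unitmx_inv pu.
  by rewrite !unitmxE BE det_ublock det1 mul1r.
move: pB; rewrite BE /frame_mx mul_row_block => /eq_row_mx[_ H].
have := congr1 (row i) H; rewrite linearD /= !row_mul !row_rowsub.
have -> r : row r (config_mx p) = p (enum_val r) by apply/rowP => j; rewrite !mxE.
have -> r : row r (config_mx q) = q (enum_val r) by apply/rowP => j; rewrite !mxE.
move=> <-; rewrite addrC; congr (_ + _).
rewrite (_ : row _ (const_mx 1) = 1%:M) ?mul1mx //.
by apply/rowP => j; rewrite !ord1 !mxE eqxx.
Qed.

(* If [g] is blind to translations by multiples of [w] of its arguments, then a
   generic framework flexes by moving one vertex off the frame along [w]. *)
Lemma rigid_no_blind_direction (v : V) (w : 'rV[R]_d) :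
  (forall i, v != enum_val (fi i)) ->
  (forall (X : 'M[R]_(k, d)) (c : 'cV[R]_k), eval_points g (X + c *m w) = eval_points g X) ->
  w = 0.
Proof.
move=> vfi Hw; have [I [B [B0 HB]]] := generic_family g E.
have [|x _ Bx] := @mpoly_avoid R N (option I)
  (fun o => if o is Some i then B i else frame_det) 0 1 _ ltr01.
  by case=> [i|]; [exact: B0 | exact: frame_det_neq0].
pose p := pt_config x; have pgen : generic g E p.
  by apply: HB => i; rewrite pt_configK; apply: (Bx (Some i)).
have pu : frame_mx p \in unitmx by rewrite frame_mx_unitE pt_configK; apply: (Bx None).
have [e e0 He] := locally_rigid_ball (hrigid pgen).
(* Each coordinate then moves by at most e / 2; the added 1 covers w = 0. *)
pose t := e / (2 * (`|w| + 1)).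
have w1 : 0 < `|w| + 1 by rewrite ltr_wpDl.
have t0 : 0 < t by rewrite divr_gt0 // mulr_gt0.
pose q : config R d V := [ffun u => if u == v then p u + t *: w else p u].
have qfi i : q (enum_val (fi i)) = p (enum_val (fi i)).
  by rewrite ffunE eq_sym (negbTE (vfi i)).
have [||th thg Eq] := He q.
- apply: (@le_lt_trans _ _ (e / 2)); last by rewrite ltr_pdivrMr // ltr_pMr // ltr1n.
  apply: rV_norm_le => [|l]; first by rewrite divr_ge0 // ltW.
  rewrite /config_pt -linearB; case/mxvec_indexP: l => i j.
  rewrite mxvecE !mxE ffunE; case: eqP => _; last first.
    by rewrite subrr normr0 divr_ge0 // ltW.
  rewrite !mxE addrAC subrr add0r normrM (gtr0_norm t0).
  apply: (@le_trans _ _ (t * (`|w| + 1))).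
    by rewrite ler_pM2l // (le_trans (coord_norm_le w j)) // lerDl.
  by rewrite /t le_eqVlt; apply/orP; left; apply/eqP; field; rewrite gt_eqF.
- apply/ffunP => e'; rewrite !ffunE.
  (* The column marks all positions at which v occurs, as a hyperedge may repeat it. *)
  rewrite -[RHS](Hw _ (\col_i (if tnth (val (val e')) i == v then t else 0))).
  congr eval_points; apply/matrixP => i j; rewrite !mxE big_ord1 !mxE ffunE.
  by case: eqP => _; rewrite ?mul0r ?addr0 // !mxE.
(* The point p v is an affine combination of frame points, which p and q share. As th is affine it
   fixes p v, although it should move it to q v. *)
have [U [HU UX UF]] := @frame_weights p 1 (p v) pu.
have [[A _ [b Hth]] _] := thg.
have := affine_weights_act p Hth HU; rewrite -Eq (UF q p qfi) UX.
move=> Epv; have : p v = q v.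
  rewrite {1}Epv [in RHS]Eq [RHS]ffunE; apply/rowP => j; rewrite mxE; congr (th _ _ _).
  by apply/rowP => l; rewrite mxE.
have -> : q v = p v + t *: w by rewrite ffunE eqxx.
rewrite -{1}[p v]addr0 => /addrI/esym/eqP.
by rewrite scaler_eq0 (gt_eqF t0) => /eqP.
Qed.

(** The affine map th matching the two frames preserves g, because every k-tuple of points has the
    form U p with U supported on the frame. At a vertex off the frame, the discrepancy between th p
    and q is a blind direction of g, hence zero. *)
Lemma comb_poly_separates p q : frame_mx p \in unitmx -> frame_mx q \in unitmx ->
  (forall U, affine_weights U ->
     (comb_poly g U).@[config_pt p 0] = (comb_poly g U).@[config_pt q 0]) ->
  exists2 th, isometries g th & act th p = q.
Proof.
move=> pu qu Hpq; have [A [b [Au Afi]]] := frame_affine pu qu.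
pose th x := x *m A + b; have Hth x : th x = x *m A + b by [].
have thfi i : act th p (enum_val (fi i)) = q (enum_val (fi i)).
  by rewrite ffunE Afi.
have thg : isometries g th.
  split; first by exists A => //; exists b.
  move=> x; have [U [HU UX UF]] := frame_weights (\matrix_i x i) pu.
  have -> : \matrix_i th (x i) = U *m config_mx (act th p).
    by rewrite (affine_weights_act _ Hth) // UX; apply/row_matrixP => i; rewrite !rowK.
  by rewrite (UF _ q thfi) -UX -!comb_polyE Hpq.
exists th => //; apply/ffunP => v; apply/eqP; rewrite -subr_eq0; apply/eqP.
have [/existsP[i /eqP ->]|] := boolP [exists i, v == enum_val (fi i)].
  by rewrite thfi subrr.
rewrite negb_exists => /forallP vfi; apply: (@rigid_no_blind_direction v) => // X c.
have [U [HU UX UF]] := frame_weights X qu.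
have [L [HL LX LF]] := @frame_weights q 1 (q v) qu.
(* L writes q v through the frame, so W sends q to X, and th p to X plus c times the discrepancy at
   v. *)
pose W := U + c *m (delta_mx 0 (enum_rank v) - L).
have HW : affine_weights W.
  rewrite /affine_weights /= mulmxDl HU -mulmxA mulmxBl HL.
  suff -> : (delta_mx 0 (enum_rank v) : 'rV[R]_#|V|) *m const_mx 1 = const_mx 1 :> 'M[R]_1.
    by rewrite subrr mulmx0 addr0.
  by rewrite -rowE; apply/matrixP => i j; rewrite !mxE.
have Wp r : W *m config_mx r = U *m config_mx r + c *m (r v - L *m config_mx r).
  by rewrite mulmxDl -mulmxA mulmxBl -rowE row_config_mx.
transitivity (eval_points g (W *m config_mx (act th p))).
  by rewrite Wp (UF _ q thfi) UX (LF _ q thfi) LX.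
rewrite -!comb_polyE comb_poly_isometry // Hpq // comb_polyE.
by rewrite Wp UX LX subrr mulmx0 addr0.
Qed.


End Rigid.

Section Constant.
Variables (R : realType) (d k : nat) (disp : Order.disp_t).
Variables (V : finOrderType disp) (g : {mpoly R[k * d]}).

(** Without hyperedges a whole ball around a generic point lies in one orbit. Every invariant is
    then constant, and these invariants reach all values of g. *)
Lemma rigid_empty_constant : (1 + d <= #|V|)%N ->
  rigid g (finset.set0 : {set hyperedge V k}) -> mpoly_deg g = 0%N.
Proof.
move=> hV hr; have [I [B [B0 HB]]] := generic_family g (finset.set0 : {set hyperedge V k}).
have [x _ Bx] := @mpoly_avoid R _ I B 0 1 B0 ltr01.
have [|e e0 He] := @locally_rigid_ball _ _ _ _ _ g finset.set0 (pt_config x).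
  by apply: hr; apply: HB => i; rewrite pt_configK.
have combC U : affine_weights U ->
    comb_poly g U = ((comb_poly g U).@[x 0])%:MP :> {mpoly R[#|V| * d]}.
  move=> HU; apply/eqP; rewrite -subr_eq0; apply/eqP.
  apply: (@mpoly_vanish_ball _ _ _ x e e0) => z zx; rewrite mevalB mevalC.
  have [| |th thg Ez] := He (pt_config z); first by rewrite !pt_configK.
    by apply/ffunP => -[e' e'0]; exfalso; rewrite inE in e'0.
  have := comb_poly_isometry (pt_config x) HU thg.
  by rewrite -Ez !pt_configK => ->; rewrite subrr.
have [q qu] := @standard_frame R d disp V hV.
have gC : g = (eval_points g 0)%:MP.
  apply: mpoly_eval_inj => y; rewrite mevalC.
  have [U [HU UX _]] := frame_weights (vec_mx y : 'M_(k, d)) qu.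
  have <- : eval_points g (vec_mx y) = g.@[y 0] by rewrite /eval_points vec_mxK.
  have HC p : eval_points g (U *m config_mx p) = (comb_poly g U).@[x 0].
    by rewrite -comb_polyE combC // !mevalC.
  by rewrite -UX HC -(HC (pt_config (mxvec 0))) config_mxK mulmx0.
by rewrite /mpoly_deg gC msizeC; case: eqP.
Qed.

End Constant.

(** The coefficient vectors lie in a finite-dimensional space; the chosen members span as much as
    possible, so all others with P are linear combinations of them. *)
Lemma finite_determination (K : fieldType) n (T : eqType) (P : T -> Prop)
    (h : T -> {mpoly K[n]}) b : (forall t, (msize (h t) <= b)%N) ->
  exists ts : seq T, (forall t, t \in ts -> P t) /\
    forall x y : 'I_n -> K, (forall t, t \in ts -> (h t).@[x] = (h t).@[y]) ->
      forall t, P t -> (h t).@[x] = (h t).@[y].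
Proof.
move=> hb; pose M := #|{: 'X_{1..n < b}}|.
pose mon (i : 'I_M) : 'X_{1..n} := bmnm (enum_val i).
pose phi t : 'rV[K]_M := \row_i (h t)@_(mon i).
pose good r := `[< exists ts : seq T, (forall t, t \in ts -> P t) /\
   \dim <<map phi ts>>%VS = r >].
have g0 : exists r, good r.
  by exists (\dim <<map phi [::]>>%VS); apply/asboolP; exists [::].
have gb r : good r -> (r <= \dim {: 'rV[K]_M})%N.
  by move=> /asboolP[ts [_ <-]]; apply: dimvS; apply: subvf.
have [r /asboolP[ts [Pts rts]] rmax] := ex_maxnP g0 gb.
exists ts; split=> // x y xy t Pt.
have phit : phi t \in <<map phi ts>>%VS.
  have sub : (<<map phi ts>> <= <<map phi (t :: ts)>>)%VS.
    by apply: sub_span => v; rewrite inE orbC => ->.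
  have : good (\dim <<map phi (t :: ts)>>%VS).
    apply/asboolP; exists (t :: ts); split=> // t'.
    by rewrite inE => /orP[/eqP->|/Pts].
  move/rmax; rewrite -rts => dle.
  have /eqP -> : (<<map phi ts>> == <<map phi (t :: ts)>>)%VS by rewrite eqEdim sub.
  by apply: memv_span; rewrite inE eqxx.
(* Pairing with w turns a coefficient vector into the difference of the values at x and y. *)
pose w : 'cV[K]_M :=
  \col_i (('X_[mon i] : {mpoly K[n]}).@[x] - ('X_[mon i] : {mpoly K[n]}).@[y]).
have hw t' : (h t').@[x] - (h t').@[y] = (phi t' *m w) 0 0.
  pose f (m : 'X_{1..n < b}) := (h t')@_m *
    (('X_[m] : {mpoly K[n]}).@[x] - ('X_[m] : {mpoly K[n]}).@[y]).
  rewrite mxE (eq_bigr (fun i => f (enum_val i))) => [|i _]; last by rewrite !mxE.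
  have ev z : (h t').@[z] = \sum_(m : 'X_{1..n < b}) (h t')@_m * ('X_[m] : {mpoly K[n]}).@[z].
    rewrite {1}(mpolywE (hb t')) raddf_sum.
    by apply: eq_bigr => m _; rewrite /= mevalZ.
  rewrite -(big_enum_val f) !ev -sumrB.
  by apply: eq_bigr => m _; rewrite -mulrBr.
apply/eqP; rewrite -subr_eq0 hw.
suff -> : phi t *m w = 0 by rewrite mxE.
rewrite (coord_span (X := in_tuple (map phi ts)) phit) mulmx_suml big1 // => i _.
rewrite -scalemxAl (_ : _ *m w = 0) ?scaler0 //.
have : (in_tuple (map phi ts))`_i \in map phi ts by apply: mem_nth.
move=> /mapP[t' t'ts ->]; apply/matrixP => a c.
by rewrite !ord1 -hw xy // subrr mxE.
Qed.

(** * Degrees in one vertex *)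

Lemma comp_mpolyA (K : comNzRingType) n m l (A : m.-tuple {mpoly K[n]})
    (B : n.-tuple {mpoly K[l]}) (p : {mpoly K[m]}) :
  (p \mPo A) \mPo B = p \mPo [tuple tnth A i \mPo B | i < m].
Proof.
elim/mpoly_ring_ind: p => [c|i|p q IHp IHq|p q IHp IHq].
- by rewrite !comp_mpolyC.
- by rewrite !comp_mpolyXU -!tnth_nth tnth_mktuple.
- by rewrite !comp_mpolyD IHp IHq.
- by rewrite !rmorphM /= IHp IHq.
Qed.

Section OneVertex.
Variables (R : realType) (d k : nat) (disp : Order.disp_t).
Variables (V : finOrderType disp) (g : {mpoly R[k * d]}).
Local Notation N := (#|V| * d)%N.
Implicit Types (p z : config R d V) (v : V) (x : 'rV[R]_d).

Definition move_vertex z v x : config R d V := [ffun u => if u == v then x else z u].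

Lemma move_vertex_id z v : move_vertex z v (z v) = z.
Proof. by apply/ffunP => u; rewrite ffunE; case: eqP => [->|]. Qed.

Definition vertex_subst z v : N.-tuple {mpoly R[d]} :=
  [tuple mxvec (\matrix_(i < #|V|, j < d)
     if enum_val i == v then 'X_j else (z (enum_val i) 0 j)%:MP) 0 l | l < N].

Lemma vertex_substE z v i j : tnth (vertex_subst z v) (mxvec_index i j) =
  if enum_val i == v then 'X_j else (z (enum_val i) 0 j)%:MP.
Proof. by rewrite tnth_mktuple mxvecE mxE. Qed.

Lemma comp_vertex_subst z v x (Q : {mpoly R[N]}) :
  (Q \mPo vertex_subst z v).@[x 0] = Q.@[config_pt (move_vertex z v x) 0].
Proof.
rewrite comp_mpoly_meval; apply: meval_eq => l; case/mxvec_indexP: l => i j.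
rewrite vertex_substE /config_pt mxvecE mxE ffunE.
by case: eqP => _; rewrite ?mevalXU ?mevalC.
Qed.

Lemma msize_vertex_subst z v i j :
  (msize (tnth (vertex_subst z v) (mxvec_index i j)) <= (enum_val i == v).+1)%N.
Proof.
by rewrite vertex_substE; case: eqP => _; rewrite ?msizeC_leq // msizeX mdeg1.
Qed.

(** If v is not in e, freezing the other vertices leaves a constant; otherwise the degree of g is
    bound enough, and the loss of degree under differentiation is ignored. *)
Lemma msize_mderiv_edge_poly (e : hyperedge V k) z v j :
  (msize ((mderiv j (edge_poly g e)) \mPo vertex_subst z v) <=
     ((v \in val e) * mpoly_deg g).+1)%N.
Proof.
rewrite /edge_poly; set L := [tuple _ | _ < _].
have LX l : exists i c, tnth L l = 'X_(mxvec_index (enum_rank (tnth (val e) i)) c).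
  by case/mxvec_indexP: l => i c; exists i, c; rewrite tnth_mktuple mxvecE mxE.
rewrite mderiv_comp raddf_sum /=; apply: msize_sum_leq => l _.
rewrite rmorphM /= comp_mpolyA -[X in (_ <= X.+1)%N]addn0.
have [i [c ->]] := LX l; rewrite mderivXU comp_mpolyC.
apply: msizeM_leq; last exact: msizeC_leq.
rewrite [X in (_ <= X.+1)%N]mulnC; apply: msize_comp_leq => [l'|]; last first.
  by apply: leq_trans (msize_mderiv g _) _; exact: leqnSn.
rewrite tnth_mktuple; have [a [b ->]] := LX l'.
rewrite comp_mpolyXU -tnth_nth (leq_trans (msize_vertex_subst _ _ _ _)) //.
rewrite enum_rankK ltnS; case: eqP => // <-.
by rewrite mem_tnth.
Qed.

(** The row of an edge has positive degree in v only if the edge contains v, and coordinate rows are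
    constant; summing over rows counts the edges at v. *)
Lemma msize_jacobian_edges (E : {set hyperedge V k}) (s : seq (hyperedge V k))
    (c : seq 'I_N) (G : N.-tuple {mpoly R[N]}) z v :
  uniq s -> {subset s <= E} ->
  tval G = [seq edge_poly g e | e <- s] ++ [seq 'X_i | i <- c] ->
  (msize (\det (jacobian G) \mPo vertex_subst z v) <=
     (max_degree E * mpoly_deg g).+1)%N.
Proof.
move=> us sE GE; rewrite -det_map_mx.
pose bs := [seq ((v \in val e) * mpoly_deg g)%N | e : hyperedge V k <- s].
have sN : (size s <= N)%N.
  by rewrite -(size_tuple G) GE size_cat size_map leq_addr.
(* The default 0 of [nth] is the degree bound of the coordinate rows. *)
apply: leq_trans (msize_det_leq (b := fun i : 'I_N => nth 0%N bs i) _) _.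
  move=> i j; rewrite !mxE (tnth_nth 0) GE nth_cat size_map.
  case: ltnP => [lt_is|ge_is].
    have e0 : hyperedge V k by case: (s) lt_is => // e.
    by rewrite !(nth_map e0) // msize_mderiv_edge_poly.
  have lt_ic : (i - size s < size c)%N.
    rewrite ltn_subLR // -[X in (_ < X + _)%N](size_map (edge_poly g)).
    rewrite -(size_map (fun i => 'X_i : {mpoly R[N]})).
    by rewrite -size_cat -GE size_tuple.
  by rewrite (nth_map i) //= mderivXU comp_mpolyC msizeC_leq.
rewrite ltnS.
apply: leq_trans (_ : \sum_(e <- s) (v \in val (e : hyperedge V k)) * mpoly_deg g <= _)%N.
  have -> : (\sum_(e <- s) (v \in val (e : hyperedge V k)) * mpoly_deg g = \sum_(b <- bs) b)%N.
    by rewrite big_map.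
  rewrite (big_nth 0%N) size_map.
  rewrite -(big_mkord xpredT (fun i => nth 0%N bs i)) (big_cat_nat (leq0n _) sN) /=.
  rewrite [X in (_ + X)%N](_ : _ = 0%N) ?addn0 // big_nat_cond big1 // => i.
  by rewrite andbT => /andP[si _]; rewrite nth_default // size_map.
rewrite -big_distrl leq_mul2r; apply/orP; right.
apply: leq_trans (_ : #|[set e in E | v \in val e]| <= _)%N; last first.
  by rewrite /max_degree (leq_bigmax v).
rewrite -big_mkcond sum1_count -size_filter.
rewrite cardE; apply: uniq_leq_size; first exact: filter_uniq.
by move=> e; rewrite mem_filter mem_enum inE => /andP[-> /sE ->].
Qed.

(** The position of v enters at most one row, so the degree in v is at most 1. *)
Lemma msize_frame_det (hV : (1 + d <= #|V|)%N) z v :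
  (msize (frame_det R hV \mPo vertex_subst z v) <= 2)%N.
Proof.
rewrite -det_map_mx.
apply: leq_trans (msize_det_leq (b := fun i : 'I_(1 + d) =>
   nat_of_bool (enum_val (widen_ord hV i) == v)) _) _.
  move=> i j; rewrite map_row_mx [X in msize X]mxE.
  case: (fintype.split j) => j'; rewrite !mxE; first by rewrite rmorph1 -mpolyC1 msizeC_leq.
  by rewrite /= comp_mpolyXU -tnth_nth msize_vertex_subst.
rewrite ltnS -big_mkcond sum1_card.
apply/card_le1_eqP => i j; rewrite !unfold_in => /eqP Ei /eqP Ej.
have /(congr1 val) : widen_ord hV i = widen_ord hV j.
  by apply: enum_val_inj; rewrite Ei Ej.
by move=> /= H; apply/val_inj; rewrite /= H.
Qed.

End OneVertex.

Lemma affine_mpoly_zero (R : realType) (c : {mpoly R[1]}) (x y : 'rV[R]_1) :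
  (msize c <= 2)%N -> x != y -> c.@[x 0] = 0 -> c.@[y 0] = 0 -> c = 0.
Proof.
move=> c2 xy cx cy.
have aff t : c.@[(x + t *: (y - x)) 0] = c.@[x 0] + t * (c.@[y 0] - c.@[x 0]).
  have ev (z : 'rV[R]_1) :
      c.@[z 0] = \sum_(m <- msupp c) c@_m * ('X_[m] : {mpoly R[1]}).@[z 0].
    by rewrite {1}(mpolyE c) raddf_sum; apply: eq_bigr => m _; rewrite /= mevalZ.
  rewrite !ev -sumrB mulr_sumr -big_split big_seq [RHS]big_seq.
  apply: eq_bigr => m mc /=.
  have : (mdeg m <= 1)%N by rewrite -ltnS; apply: leq_trans c2; apply: msize_mdeg_lt.
  rewrite leq_eqVlt ltnS leqn0 => /orP[/mdeg1P[i /eqP ->]|].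
    by rewrite !mevalXU !mxE; ring.
  by rewrite mdeg_eq0 => /eqP ->; rewrite mpolyX0 !meval1 subrr mulr0 addr0.
apply: mpoly_eval_inj => z; rewrite meval0.
have xy0 : y 0 0 - x 0 0 != 0.
  rewrite subr_eq0; apply: contraNneq xy => E; apply/eqP/rowP => j.
  by rewrite !ord1.
have -> : z = x + ((z 0 0 - x 0 0) / (y 0 0 - x 0 0)) *: (y - x).
  by apply/rowP => j; rewrite !ord1 !mxE; field.
by rewrite aff cx cy subrr mulr0 addr0.
Qed.

(** * Counting *)

Section Counting.
Variable R : realType.

Lemma uniq_flatten_map (A B C : eqType) (s : seq A) (F : A -> seq B) (f : B -> C)
    (c : A -> C) : injective c ->
  uniq s -> (forall x, x \in s -> uniq (F x)) ->
  (forall x p, x \in s -> p \in F x -> f p = c x) -> uniq (flatten (map F s)).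
Proof.
move=> cinj; elim: s => //= x s IH /andP[xs us] HF Hf.
rewrite cat_uniq HF ?inE ?eqxx //= IH //; last 2 first.
- by move=> y ys; apply: HF; rewrite inE ys orbT.
- by move=> y p ys; apply: Hf; rewrite inE ys orbT.
rewrite andbT; apply/hasPn => p /flatten_mapP[y ys py]; apply/negP => px.
have := Hf x p; rewrite inE eqxx => /(_ isT px).
have -> := Hf y p; rewrite ?inE ?ys ?orbT // => /cinj E.
by rewrite -E ys in xs.
Qed.

Section Refine.
Variables (d : nat) (disp : Order.disp_t) (V : finOrderType disp).
Variables (P : {fset 'rV[R]_d}) (good : pred (config R d V)).

(** Each move must keep the intermediate configuration [good]. The starting configuration need not
    have its points in P: after passing through all vertices none of its points is left. *)
Fixpoint refine (z : config R d V) (vs : seq V) : seq (config R d V) :=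
  if vs is v :: vs' then
    flatten [seq refine (move_vertex z v x) vs' | x <- [seq x <- P | good (move_vertex z v x)]]
  else [:: z].

Lemma refine_good z vs p : good z -> p \in refine z vs -> good p.
Proof.
elim: vs z => [|v vs IH] z gz /=; first by rewrite inE => /eqP->.
by move=> /flatten_mapP[x]; rewrite mem_filter => /andP[gx _]; apply: IH.
Qed.

Lemma refine_off z vs p u : p \in refine z vs -> u \notin vs -> p u = z u.
Proof.
elim: vs z => [|v vs IH] z /=; first by rewrite inE => /eqP->.
move=> /flatten_mapP[x _ /IH H]; rewrite inE negb_or => /andP[uv /H ->].
by rewrite ffunE (negbTE uv).
Qed.

Lemma refine_in z vs p u : uniq vs -> p \in refine z vs -> u \in vs -> p u \in P.
Proof.
elim: vs z => [|v vs IH] z //= /andP[vvs uvs].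
move=> /flatten_mapP[x]; rewrite mem_filter => /andP[_ xP] px.
rewrite inE => /orP[/eqP->|]; last exact: IH px.
by rewrite (refine_off px vvs) ffunE eqxx.
Qed.

Lemma refine_uniq z vs : uniq vs -> uniq (refine z vs).
Proof.
elim: vs z => [|v vs IH] z //= /andP[vvs uvs].
apply: (@uniq_flatten_map _ _ _ _ _ (fun p : config R d V => p v) id) => //.
- by rewrite filter_uniq // fset_uniq.
- by move=> x _; apply: IH.
- by move=> x p _ /refine_off/(_ vvs) ->; rewrite ffunE eqxx.
Qed.

Lemma refine_size (rho : R) z vs : 0 <= rho -> good z ->
  (forall y v, good y -> rho <= (size [seq x <- P | good (move_vertex y v x)])%:R) ->
  rho ^+ size vs <= (size (refine z vs))%:R.
Proof.
move=> rho0 gz H; elim: vs z gz => [|v vs IH] z gz /=; first by rewrite expr0.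
rewrite size_flatten /shape -map_comp sumnE big_map natr_sum exprS.
rewrite big_seq.
apply: (@le_trans _ _ (\sum_(x <- [seq x <- P | good (move_vertex z v x)] |
   x \in [seq x <- P | good (move_vertex z v x)]) rho ^+ size vs)).
  rewrite -big_seq big_const_seq count_predT iter_addr_0 -mulr_natl.
  by rewrite ler_wpM2r ?exprn_ge0 // H.
by apply: ler_sum => x; rewrite mem_filter => /andP[gx _]; apply: IH.
Qed.

End Refine.

(** A pair is coded by the index of its first entry among the values of f and of its second entry
    among the values of h on that fibre. *)
Lemma size_undup_pair (T A B : eqType) (s : seq T) (f : T -> A) (h : T -> B) C :
  (forall a, (size (undup [seq h x | x <- s & f x == a]) <= C)%N) ->
  (size (undup [seq (f x, h x) | x <- s]) <= size (undup (map f s)) * C)%N.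
Proof.
move=> HC; set t := undup _; set L := undup (map f s).
pose H a := undup [seq h x | x <- s & f x == a].
pose io (ab : A * B) := (index ab.1 L, index ab.2 (H ab.1)).
have tP ab : ab \in t -> ab.1 \in L /\ ab.2 \in H ab.1.
  rewrite mem_undup => /mapP[x xs ->] /=; split; first by rewrite mem_undup map_f.
  by rewrite mem_undup; apply/mapP; exists x; rewrite // mem_filter eqxx.
rewrite -(size_map io) -(size_iota 0 (size L)) -[X in (_ <= _ * X)%N](size_iota 0 C).
rewrite -(size_allpairs pair); apply: uniq_leq_size.
  rewrite map_inj_in_uniq ?undup_uniq // => -[a b] [a' b'] /tP[/= aL bH] /tP[/= aL' bH'].
  move=> [Ea Eb]; have E : a = a' by rewrite -(nth_index a aL) Ea nth_index.
  by subst a'; rewrite -(nth_index b bH) Eb nth_index.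
move=> _ /mapP[[a b] /tP[/= aL bH] ->]; apply/allpairsP; exists (io (a, b)); split=> //=.
  by rewrite mem_iota /= add0n index_mem.
by rewrite mem_iota /= add0n (leq_trans _ (HC a)) // index_mem.
Qed.

Lemma size_undup_seq (T A B I : eqType) (s : seq T) (f : T -> A) (h : I -> T -> B)
    (hs : seq I) C :
  (forall i a, i \in hs -> (size (undup [seq h i x | x <- s & f x == a]) <= C)%N) ->
  (size (undup [seq (f x, [seq h i x | i <- hs]) | x <- s]) <=
     size (undup (map f s)) * C ^ size hs)%N.
Proof.
elim: hs => [|i hs IH] HC /=.
  rewrite muln1 -[X in (_ <= X)%N](size_map (fun a => (a, [::] : seq B))).
  apply: uniq_leq_size; first exact: undup_uniq.
  move=> ab; rewrite mem_undup => /mapP[x xs ->]; apply/mapP; exists (f x) => //.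
  by rewrite mem_undup map_f.
pose f' x := (f x, [seq h i x | i <- hs]).
have : (size (undup [seq (f' x, h i x) | x <- s]) <= size (undup (map f' s)) * C)%N.
  apply: size_undup_pair => -[a l]; apply: leq_trans (HC i a _); last by rewrite inE eqxx.
  apply: uniq_leq_size; first exact: undup_uniq.
  move=> b; rewrite !mem_undup => /mapP[x]; rewrite mem_filter => /andP[/eqP[Ea _] xs ->].
  by apply/mapP; exists x => //; rewrite mem_filter Ea eqxx.
move=> H; apply: leq_trans (leq_trans H _); last first.
  rewrite expnSr mulnA leq_mul2r IH ?orbT // => j a js.
  by apply: HC; rewrite inE js orbT.
rewrite -[X in (_ <= X)%N](size_map (fun al : (A * seq B) * B => (al.1.1, al.2 :: al.1.2))).
apply: uniq_leq_size; first exact: undup_uniq.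
move=> ab; rewrite mem_undup => /mapP[x xs ->]; apply/mapP; exists (f' x, h i x) => //.
by rewrite mem_undup; apply/mapP; exists x.
Qed.

Lemma pairs_cauchy_schwarz (T A : eqType) (s : seq T) (f : T -> A) :
  (size s)%:R ^+ 2 <= (size (undup (map f s)))%:R *
    (size [seq xy <- [seq (x, y) | x <- s, y <- s] | f xy.1 == f xy.2])%:R :> R.
Proof.
set L := undup _; set M := size s; set Q := size [seq _ <- _ | _].
pose m a := count (fun x => f x == a) s.
have part (G : T -> nat) : (\sum_(x <- s) G x = \sum_(a <- L) \sum_(x <- s | f x == a) G x)%N.
  rewrite (exchange_big_dep xpredT) //= big_seq [RHS]big_seq; apply: eq_bigr => x xs.
  rewrite -big_filter (_ : [seq a <- L | f x == a] = [:: f x]) ?big_seq1 //.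
  rewrite (eq_filter (a2 := pred1 (f x))) => [|a]; last by rewrite /= eq_sym.
  by rewrite filter_pred1_uniq ?undup_uniq // mem_undup map_f.
have EM : M = (\sum_(a <- L) m a)%N.
  rewrite /M -sum1_size part; apply: eq_bigr => a _; exact: sum1_count.
have EQ : Q = (\sum_(a <- L) m a ^ 2)%N.
  rewrite /Q size_filter count_flatten -map_comp sumnE big_map part.
  apply: eq_bigr => a _; rewrite (eq_bigr (fun=> m a)) => [|x /eqP <-].
    by rewrite big_const_seq iter_addn_0 mulnn.
  by rewrite /= count_map; apply: eq_count => y /=; rewrite eq_sym.
have [L0|L0] := posnP (size L).
  have -> : M = 0%N by rewrite EM (size0nil L0) big_nil.
  by rewrite expr0n /= mulr_ge0.
(* With t the mean fibre size, summing (m a - t)^2 >= 0 over the fibres gives the inequality. *)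
pose t : R := M%:R / (size L)%:R.
have L0' : 0 < (size L)%:R :> R by rewrite ltr0n.
have : \sum_(a <- L) (2 * t * (m a)%:R - t ^+ 2) <= Q%:R.
  rewrite EQ natr_sum; apply: ler_sum => a _; rewrite natrX.
  by rewrite -subr_ge0 (_ : _ - _ = ((m a)%:R - t) ^+ 2) ?sqr_ge0 //; ring.
rewrite sumrB -mulr_sumr -natr_sum -EM big_const_seq count_predT iter_addr_0 => H.
rewrite -ler_pdivrMl //; apply: le_trans H; rewrite -mulr_natl /t.
by rewrite le_eqVlt; apply/orP; left; apply/eqP; field; rewrite gt_eqF.
Qed.

Lemma undup_map_repr (T B : eqType) (s : seq T) (h : T -> B) :
  exists2 ps, {subset ps <= s} & map h ps = undup (map h s).
Proof.
elim: s => [|x s [ps pss E]]; first by exists [::].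
rewrite /=; case: ifP => _.
  by exists ps => // y /pss; rewrite inE => ->; rewrite orbT.
exists (x :: ps); last by rewrite /= E.
by move=> y; rewrite !inE => /orP[->//|/pss ->]; rewrite orbT.
Qed.

End Counting.

(** * The energy bound *)

Section EdgeMap.
Variables (R : realType) (d k : nat) (disp : Order.disp_t).
Variables (V : finOrderType disp) (g : {mpoly R[k * d]}).
Variables (E : {set hyperedge V k}).
Hypothesis hrigid : rigid g E.
Hypothesis hV : (1 + d <= #|V|)%N.
Local Notation N := (#|V| * d)%N.

(** A selection of maximal size. Members of the family form a separate alternative, which avoids
    discussing repeated polynomials. *)
Lemma maximal_independent_edges : exists s : seq (hyperedge V k),
  [/\ uniq s, {subset s <= E}, algindep [seq edge_poly g e | e <- s] &
   forall e, e \in E -> edge_poly g e \in [seq edge_poly g e | e <- s] \/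
     ~ algindep (rcons [seq edge_poly g e | e <- s] (edge_poly g e))].
Proof.
pose good r := `[< exists s : seq (hyperedge V k), [/\ uniq s, {subset s <= E},
  algindep [seq edge_poly g e | e <- s] & size s = r] >].
have g0 : exists r, good r.
  by exists 0%N; apply/asboolP; exists [::]; split=> //; exact: algindep_nil.
have gb r : good r -> (r <= #|E|)%N.
  move=> /asboolP[s [us sE _ <-]]; rewrite cardE; apply: uniq_leq_size => // e /sE.
  by rewrite mem_enum.
have [r /asboolP[s [us sE sind sr]] rmax] := ex_maxnP g0 gb.
exists s; split=> // e eE; have [es|es] := boolP (e \in s).
  by left; apply: map_f.
right => Hind; have : good r.+1; last by move/rmax; rewrite ltnn.
apply/asboolP; exists (rcons s e); split.
- by rewrite rcons_uniq es.
- by move=> e'; rewrite mem_rcons inE => /orP[/eqP->|/sE].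
- by rewrite map_rcons.
- by rewrite size_rcons sr.
Qed.

Lemma msize_comb_poly (U : 'M[R]_(k, #|V|)) :
  (msize (comb_poly g U) <= (mpoly_deg g).+1)%N.
Proof.
rewrite /comb_poly -[X in (_ <= X.+1)%N]muln1.
apply: msize_comp_leq => [l|]; last exact: leqSpred.
rewrite tnth_mktuple; case/mxvec_indexP: l => i j; rewrite mxvecE mxE.
apply: msize_sum_leq => v _; apply: leq_trans (msizeZ_le _ _) _.
by rewrite msizeX mdeg1.
Qed.

Lemma comb_poly_values_bound (s : seq (hyperedge V k)) (c : seq 'I_N)
    (G : N.-tuple {mpoly R[N]}) U :
  {subset s <= E} -> algindep [seq edge_poly g e | e <- s] ->
  (forall e, e \in E -> edge_poly g e \in [seq edge_poly g e | e <- s] \/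
     ~ algindep (rcons [seq edge_poly g e | e <- s] (edge_poly g e))) ->
  tval G = [seq edge_poly g e | e <- s] ++ [seq 'X_i | i <- c] ->
  affine_weights U ->
  exists C, forall (ps : seq (config R d V)) a,
    (forall p, p \in ps -> (\det (jacobian G)).@[config_pt p 0] != 0) ->
    (size (undup [seq (comb_poly g U).@[config_pt p 0%R] | p <- ps & measurement g E p == a])
      <= C)%N.
Proof.
move=> sE sind smax GE HU; pose F := in_tuple [seq edge_poly g e | e <- s].
have nF := @comb_poly_dependent _ _ _ _ _ g E hrigid _ F U sind smax HU.
have [q q0 rq] := not_algindep_rcons nF.
exists (size q) => ps a psD.
(* One representative for each value, so that [fibre_values_bound] applies. *)
have [qs qps Eqs] := undup_map_repr [seq p <- ps | measurement g E p == a]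
   (fun p => (comb_poly g U).@[config_pt p 0]).
rewrite -Eqs size_map -(size_map (@config_pt R d disp V)); apply/ltnW.
apply: (@fibre_values_bound R N _ F G [seq 'X_i | i <- c] q (comb_poly g U)) => //.
- by move=> _ /mapP[p /qps + ->]; rewrite mem_filter => /andP[_ /psD].
- move=> _ _ /mapP[p /qps + ->] /mapP[p' /qps + ->].
  rewrite !mem_filter => /andP[/eqP pa _] /andP[/eqP p'a _].
  apply/rowP => i; rewrite !mxE; have /mapP[e es ->] := mem_tnth i F.
  by have /measurement_eqP := etrans pa (esym p'a); apply; apply: sE.
- by rewrite -map_comp; have := undup_uniq [seq (comb_poly g U).@[config_pt p 0%R] |
    p <- [seq p <- ps | measurement g E p == a]]; rewrite -Eqs.
Qed.

Lemma size_filter_fset (P : {fset 'rV[R]_d}) (Q : 'rV[R]_d -> bool) (C : set 'rV[R]_d) :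
  (forall x, Q x -> C x) ->
  (size [seq x <- P | Q x] <= #|` [fset x in P | x \in C]%fset|)%N.
Proof.
move=> QC; apply: uniq_leq_size; first by rewrite filter_uniq // fset_uniq.
move=> x; rewrite mem_filter => /andP[Qx xP]; rewrite !inE xP /=.
exact/mem_set/QC.
Qed.

Lemma hypersurface_zeros (P : {fset 'rV[R]_d}) B (c : {mpoly R[d]}) :
  (forall C : set 'rV[R]_d, hypersurface_deg_le B C ->
     #|` [fset x in P | x \in C]%fset |%:R <= 100%:R^-1 * #|` P|%:R :> R) ->
  c != 0 -> (msize c <= B.+1)%N ->
  (size [seq x : 'rV[R]_d <- P | c.@[x 0%R] == 0])%:R <= 100%:R^-1 * #|` P|%:R :> R.
Proof.
move=> HP c0 cB; apply: le_trans (HP [set x | c.@[x 0] = 0]%classic _).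
  by rewrite ler_nat size_filter_fset // => x /eqP.
exists c; split=> //; rewrite /mpoly_deg.
by case: (msize c) cB.
Qed.

(** On the line the allowed degree can be 0, so the assumption on P may say nothing about single
    points. Instead, the at most one zero is at most a hundredth of 100 points. *)
Lemma affine_zeros (P : {fset 'rV[R]_d}) (c : {mpoly R[d]}) : d = 1%N ->
  (100 <= #|` P|)%N -> c != 0 -> (msize c <= 2)%N ->
  (size [seq x : 'rV[R]_d <- P | c.@[x 0%R] == 0])%:R <= 100%:R^-1 * #|` P|%:R :> R.
Proof.
move=> d1 P100 c0 c2; apply: (@le_trans _ _ 1).
  rewrite -[leRHS]/(1%:R) ler_nat leqNgt; apply/negP.
  have : uniq [seq x : 'rV[R]_d <- P | c.@[x 0%R] == 0] by rewrite filter_uniq // fset_uniq.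
  have : all (fun x : 'rV[R]_d => c.@[x 0%R] == 0) [seq x : 'rV[R]_d <- P | c.@[x 0%R] == 0].
    exact: filter_all.
  case: [seq _ <- _ | _] => [|x [|y l]] //= /and3P[/eqP cx /eqP cy _] /andP[+ _] _.
  rewrite inE negb_or => /andP[xy _]; move: c0; apply/negP; rewrite negbK; apply/eqP.
  by move: c x y c2 xy cx cy; rewrite d1; exact: affine_mpoly_zero.
by rewrite -ler_pdivrMl ?invr_gt0 ?ltr0n // invrK mulr1 ler_nat.
Qed.

End EdgeMap.

Section GoodConfigurations.
Variables (R : realType) (d k : nat) (disp : Order.disp_t).
Variables (V : finOrderType disp) (g : {mpoly R[k * d]}).
Variables (E : {set hyperedge V k}).
Hypothesis hrigid : rigid g E.
Hypothesis hV : (1 + d <= #|V|)%N.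
Hypothesis hd : (1 <= d)%N.
Hypothesis hk : (1 <= k)%N.
Hypothesis hgc : (2 <= d)%N -> (1 <= mpoly_deg g)%N.
Local Notation N := (#|V| * d)%N.

(** This brings hyperplanes within the assumption on P. An empty edge set is excluded by
    [rigid_empty_constant]. *)
Lemma degree_bound_gt0 : (2 <= d)%N -> (0 < max_degree E * mpoly_deg g)%N.
Proof.
move=> d2; rewrite muln_gt0 hgc // andbT.
have [E0|[e eE]] := finset.set_0Vmem E.
  have := hgc d2; rewrite (@rigid_empty_constant _ _ _ _ _ g hV) //.
  by rewrite -E0.
apply: leq_trans (leq_bigmax (tnth (val e) (Ordinal hk))).
by rewrite card_gt0; apply/finset.set0Pn; exists e; rewrite inE eE mem_tnth.
Qed.

(** As functions of the position of v, both polynomials are non-zero at z v, so each excludes at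
    most a hundredth of P; 98/100 remain. *)
Lemma good_moves (D : {mpoly R[N]}) (P : {fset 'rV[R]_d}) z v :
  (forall z v, (msize (D \mPo vertex_subst z v) <= (max_degree E * mpoly_deg g).+1)%N) ->
  (forall C : set 'rV[R]_d, hypersurface_deg_le (max_degree E * mpoly_deg g) C ->
     #|` [fset x in P | x \in C]%fset |%:R <= 100%:R^-1 * #|` P|%:R :> R) ->
  (100 <= #|` P|)%N ->
  let good p := (D.@[config_pt p 0] != 0) && ((frame_det R hV).@[config_pt p 0] != 0) in
  good z ->
  49%:R / 50%:R * #|` P|%:R <= (size [seq x <- P | good (move_vertex z v x)])%:R :> R.
Proof.
move=> Ddeg HP P100 good /andP[Dz fz].
pose c1 := D \mPo vertex_subst z v; pose c2 := frame_det R hV \mPo vertex_subst z v.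
have c10 : c1 != 0.
  apply: contraNneq Dz => c10; rewrite -(move_vertex_id z v) -comp_vertex_subst.
  by rewrite -/c1 c10 meval0.
have c20 : c2 != 0.
  apply: contraNneq fz => c20; rewrite -(move_vertex_id z v) -comp_vertex_subst.
  by rewrite -/c2 c20 meval0.
have H1 := hypersurface_zeros HP c10 (Ddeg z v).
have H2 : (size [seq x : 'rV[R]_d <- P | c2.@[x 0%R] == 0])%:R <= 100%:R^-1 * #|` P|%:R :> R.
  have c2_le : (msize c2 <= 2)%N by exact: msize_frame_det.
  have [d1|d1] := eqVneq d 1%N; first exact: affine_zeros.
  apply: (hypersurface_zeros HP) => //; apply: leq_trans c2_le _.
  by rewrite ltnS degree_bound_gt0 // ltn_neqAle eq_sym d1.
have : (#|` P| <= size [seq x <- P | good (move_vertex z v x)] +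
   (size [seq x : 'rV[R]_d <- P | c1.@[x 0%R] == 0%R] +
    size [seq x : 'rV[R]_d <- P | c2.@[x 0%R] == 0%R]))%N.
  rewrite !size_filter -(count_predC (fun x => good (move_vertex z v x)) P) leq_add2l.
  rewrite -count_predUI; apply: leq_trans (leq_addr _ _); apply: sub_count => x /=.
  by rewrite /good negb_and !negbK -!comp_vertex_subst.
rewrite -(ler_nat R) !natrD; lra.
Qed.

End GoodConfigurations.

(* A constant g is excluded unless d = 1: when d >= 2, g is constant and G has
   exactly d + 1 vertices, G is g-rigid and the hypothesis on P is empty, but
   the inequality fails for sets P of collinear points. *)
Theorem theorem1p5 (R : realType) (d k : nat) (hd : (1 <= d)%N) (hk : (1 <= k)%N)
    (g : {mpoly R[k * d]})
    (hg : block_symmetric g \/ block_antisymmetric g)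
    (hgc : (2 <= d)%N -> (1 <= mpoly_deg g)%N)
    (disp : Order.disp_t) (V : finOrderType disp) (E : {set hyperedge V k})
    (hV : (d + 1 <= #|V|)%N) (hrigid : rigid g E) :
  exists2 c : R, 0 < c &
  exists N : nat, forall P : {fset 'rV[R]_d},
    (N <= #|` P|)%N ->
    (forall C : set 'rV[R]_d,
        hypersurface_deg_le (max_degree E * mpoly_deg g) C ->
        #|` [fset x in P | x \in C]%fset |%:R <= 100%:R^-1 * #|` P|%:R :> R) ->
    #|` P|%:R ^+ (2 * #|V|) <=
      c * (#|` [fset measurement g E p | p in configs_in V P]%fset |%:R *
           #|` energy_set V (isometries g) P|%:R).
Proof.
move: hV; rewrite addnC => hV1.
have [s [us sE sind smax]] := maximal_independent_edges g E.
have [G [cs [GE J0]]] := algindep_extend sind.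
pose D := \det (jacobian G).
have [Us [UsP Usdet]] := finite_determination (fun U : 'M[R]_(k, #|V|) => affine_weights U)
  (@msize_comb_poly R d k disp V g).
have /choice[CU HCU] : forall U, exists C, U \in Us ->
    forall (ps : seq (config R d V)) a,
    (forall p, p \in ps -> (\det (jacobian G)).@[config_pt p 0] != 0) ->
    (size (undup [seq (comb_poly g U).@[config_pt p 0%R] | p <- ps & measurement g E p == a])
      <= C)%N.
  move=> U; have [/UsP HU|] := boolP (U \in Us); last by exists 0%N.
  by have [C HC] := comb_poly_values_bound hrigid sE sind smax GE HU; exists C.
pose C := (\max_(U <- Us) CU U)%N.
have [z0 z0D z0f] : exists2 z : config R d V, D.@[config_pt z 0] != 0 &
    (frame_det R hV1).@[config_pt z 0] != 0.
  have [x] := mpoly_neq0_ex (mulf_neq0 J0 (frame_det_neq0 R hV1)).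
  by rewrite mevalM mulf_eq0 negb_or => /andP[Dx fx]; exists (pt_config x); rewrite pt_configK.
pose r : R := 49%:R / 50%:R; have r0 : 0 < r by rewrite divr_gt0.
have rn0 : 0 < r ^+ #|V| by rewrite exprn_gt0.
pose K := (C ^ size Us)%N.
(* The inverse square comes from squaring the lower bound for the size of S; the added 1 keeps the
   constant positive when K = 0. *)
exists ((r ^+ #|V|) ^- 2 * (K%:R + 1)).
  by rewrite mulr_gt0 ?ltr_wpDl // invr_gt0 exprn_gt0.
exists 100 => P P100 HP.
pose good p := (D.@[config_pt p 0] != 0) && ((frame_det R hV1).@[config_pt p 0] != 0).
pose S := refine P good z0 (enum V).
have gz0 : good z0 by rewrite /good z0D.
have Sgood p : p \in S -> good p by apply: refine_good.
have Sin p : p \in S -> p \in configs_in V P.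
  by move=> pS; apply/configs_inP => v; apply: refine_in (enum_uniq V) pS _; rewrite mem_enum.
have Suniq : uniq S by apply: refine_uniq; exact: enum_uniq.
have Ssize : (r * #|` P|%:R) ^+ #|V| <= (size S)%:R.
  rewrite cardE; apply: refine_size => //; first by rewrite mulr_ge0 // ltW.
  move=> z v gz; apply: (@good_moves _ _ _ _ _ g E) => // z' v'.
  exact: msize_jacobian_edges us sE GE.
pose f p := (measurement g E p, [seq (comb_poly g U).@[config_pt p 0%R] | U <- Us]).
have Sclasses : (size (undup (map f S)) <=
    #|` [fset measurement g E p | p in configs_in V P]%fset| * K)%N.
  apply: leq_trans (size_undup_seq (C := C) _) _.
    move=> U a UUs; apply: leq_trans (HCU U UUs S a _) _.
      by move=> p /Sgood/andP[].
    by apply: leq_bigmax_seq.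
  rewrite leq_mul2r; apply/orP; right; apply: uniq_leq_size; first exact: undup_uniq.
  move=> y; rewrite mem_undup => /mapP[p /Sin pP ->]; apply/imfsetP.
  by exists p.
(* Agreement on [Us] forces agreement for all affine weights, so two such configurations lie in one
   orbit. *)
have Spairs : (size [seq xy <- [seq (x, y) | x <- S, y <- S] | f xy.1 == f xy.2] <=
    #|` energy_set V (isometries g) P|)%N.
  apply: uniq_leq_size.
    rewrite filter_uniq //; apply: allpairs_uniq => //.
    by move=> [x y] [x' y'] _ _ [-> ->].
  move=> [p q]; rewrite mem_filter => /andP[/eqP[_ /eq_in_map fpq]].
  move=> /allpairsP[[p' q'] /= [pS qS [Ep Eq]]]; subst p' q'.
  have /andP[_ pf] := Sgood p pS; have /andP[_ qf] := Sgood q qS.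
  rewrite !inE /= !Sin //=; apply/asboolP.
  apply: (comb_poly_separates hrigid (hV := hV1)); rewrite ?frame_mx_unitE //.
  by move=> U HU; apply: Usdet HU.
have CS := pairs_cauchy_schwarz R S f.
set M := #|` [fset _ | _ in _]%fset|; set Q := #|` energy_set _ _ _|.
have H : (r * #|` P|%:R) ^+ #|V| ^+ 2 <= (K%:R + 1) * (M%:R * Q%:R).
  apply: (@le_trans _ _ ((size S)%:R ^+ 2)).
    by rewrite lerXn2r ?nnegrE ?exprn_ge0 ?mulr_ge0 // ltW.
  apply: le_trans CS _; apply: (@le_trans _ _ ((M * K)%:R * Q%:R)).
    by rewrite ler_pM // ler_nat.
  by rewrite natrM mulrAC mulrC ler_wpM2r ?mulr_ge0 // lerDl.
rewrite -mulrA mulrC -ler_pdivrMr ?invr_gt0 ?exprn_gt0 // invrK.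
have -> : #|` P|%:R ^+ (2 * #|V|) = #|` P|%:R ^+ #|V| ^+ 2 :> R by rewrite mulnC exprM.
by rewrite -exprMn -exprMn mulrC.
Qed.
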